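(* Let $0<\alpha<1$. Let $F_n$ be a consistent sequence of alternatives and let $F_{1n}$ be any inconsistent sequence of alternatives such that $F_{2n}(x)=F_n(x)+F_{1n}(x)-F_0(x)$ are distribution functions. Then for every sequence of Cramér–von Mises tests $K_n$ with $\alpha(K_n)=\alpha(1+o(1))$, $$\lim_{n\to\infty}\big(\beta_{F_n}(K_n)-\beta_{F_{2n}}(K_n)\big)=0 .$$
   Context: $X_1,\dots,X_n$ are i.i.d. with (Borel) distribution function $F$ on $[0,1]$, $\hat F_n$ is the empirical distribution function, $F_0(x)=x$, $H_0:F=F_0$, and $T^2(G)=\int_0^1G^2(x)dx$. A Cramér–von Mises test rejects $H_0$ iff $nT^2(\hat F_n-F_0)$ exceeds a threshold; $\alpha(K_n)$ is the type I error probability and $\beta_F(K_n)$ the type II error probability under $F$. A sequence of distribution functions $F_n$ is consistent if for every $\alpha\in(0,1)$ and every sequence of Cramér–von Mises tests $K_n$ with $\alpha(K_n)=\alpha(1+o(1))$, $\limsup_n\beta_{F_n}(K_n)<1-\alpha$; it is inconsistent if for every sequence of Cramér–von Mises tests $K_n$, $\liminf_n(\alpha(K_n)+\beta_{F_n}(K_n))\ge1$. *)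

(* Defs.v *)
From HB Require Import structures.
From mathcomp Require Import all_boot all_order all_algebra.
From mathcomp Require Import all_classical all_reals all_analysis.
Set Implicit Arguments. Unset Strict Implicit. Unset Printing Implicit Defensive.
Import Order.TTheory GRing.Theory Num.Theory.
Import numFieldNormedType.Exports.
Local Open Scope classical_set_scope.
Local Open Scope ring_scope.

Section CvM.
Variable R : realType.

Definition F0 (x : R) : R := Num.min (Num.max x 0) 1.

Definition on01 (P : probability (measurableTypeR R) R) : Prop := P `[0, 1]%classic = 1%:E.

Definition distr_fun (P : probability (measurableTypeR R) R) (x : R) : R := fine (P `]-oo, x]%classic).

Definition Unif : probability (measurableTypeR R) R := (uniform_prob (@ltr01 R) : probability _ R).

Definition edf (s : seq R) (x : R) : R :=
  (count (fun y => y <= x) s)%:R / (size s)%:R.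

Definition T2 (G : R -> R) : R :=
  fine (\int[@lebesgue_measure R]_(x in `[0, 1]%classic) ((G x) ^+ 2)%:E).

Definition cvm_stat (s : seq R) : R := (size s)%:R * T2 (fun x => edf s x - F0 x).

(* E[g(X_1,...,X_n)] for X_1..X_n i.i.d. with law P (iterated integral = integral
   w.r.t. the n-fold product measure P^n by Tonelli, g being nonnegative) *)
Fixpoint iid_int (P : probability (measurableTypeR R) R) (n : nat) (g : seq R -> \bar R) : \bar R :=
  match n with
  | 0 => g [::]
  | m.+1 => (\int[P]_x iid_int P m (fun s => g (x :: s)))%E
  end.

Definition rej (P : probability (measurableTypeR R) R) (n : nat) (c : R) : R :=
  fine (iid_int P n (fun s => ((c < cvm_stat s)%R%:R)%:E)).

(* a sequence of CvM tests K_n is given by a sequence of thresholds c : nat -> R *)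
Definition alphaK (c : nat -> R) (n : nat) : R := rej Unif n (c n).
Definition betaK (P : nat -> probability (measurableTypeR R) R) (c : nat -> R) (n : nat) : R :=
  1 - rej (P n) n (c n).

Definition asym_level (c : nat -> R) (a : R) : Prop :=
  (fun n => alphaK c n / a) @ \oo --> (1 : R).

Definition consistent (P : nat -> probability (measurableTypeR R) R) : Prop :=
  forall a : R, 0 < a < 1 -> forall c : nat -> R, asym_level c a ->
    (limn_esup (fun n => (betaK P c n)%:E) < (1 - a)%:E)%E.

Definition inconsistent (P : nat -> probability (measurableTypeR R) R) : Prop :=
  forall c : nat -> R,
    (1%:E <= limn_einf (fun n => (alphaK c n + betaK P c n)%:E))%E.

End CvM.

(* Main.v *)
(**
  Write [S_p] for the statistic of a sample with distribution function [p], realized as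
  [S_p = (1/n) * int_0^1 (sum_i (1[u_i <= p t] - t))^2 dt] with uniform [u_1, ..., u_n], so
  that all alternatives live on one probability space.

  If [n * int (F_1n - F_0)^2] did not tend to zero, then the mean of [S] under [F_1n] would
  exceed its mean under [F_0]; as means are integrals of tail probabilities and second moments
  stay bounded, some fixed threshold would yield a test that contradicts inconsistency. Hence
  the statistics of [F_n] and [F_2n] differ by a quantity that tends to zero in probability,
  and the two type II errors agree in the limit unless [S] puts mass near the threshold.

  If [n * int (F_n - F_0)^2] is large, both errors are close to zero. Otherwise [S] does not
  concentrate: replacing [p] by [p + th * min(p, 1 - p)] with [th] of order [1/sqrt n]
  amounts to a change of measure that is small in total variation, while it moves the
  statistic along a quadratic in [th] whose leading coefficient is bounded below. Such a
  quadratic visits a narrow window for at most two of [J] equally spaced values of [th], so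
  the window has probability about [2/J].
*)

Require Import Defs.
From HB Require Import structures.
From mathcomp Require Import all_boot all_order all_algebra.
From mathcomp Require Import all_classical all_reals all_analysis.
From mathcomp Require Import measurable_realfun.
From mathcomp Require Import ring lra.
Import Order.TTheory GRing.Theory Num.Theory.
Import numFieldNormedType.Exports.
Local Open Scope classical_set_scope.
Local Open Scope ring_scope.

Set Implicit Arguments.
Unset Strict Implicit.
Unset Printing Implicit Defensive.

(** * Expectations of bounded measurable functions *)

(** The alternatives may vary arbitrarily with n, so the statistic has no limit law to appeal to:
    non-concentration has to be proved at finite n, with bounds uniform in the distribution function
    and in the threshold. The scale 1/sqrt n of the tilt balances two demands. The likelihood ratio
    of n tilted observations has mean 1 and second moment (1 + th^2)^n, so n th^2 must stay small;
    on the other hand the tilt moves the mean of the process by n th min(p, 1 - p), which at this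
    scale is of order sqrt n, the size of its fluctuations. The tilt direction cannot degenerate:
    bounded drift forces p close to F_0 in L^2, and min(t, 1 - t) is bounded below in the middle of
    [0, 1]. All comparisons are made in L^2 of t, where the statistic is a squared norm.
    Fluctuations of the difference of two processes are then of first order in |p - q|, while the
    shift of its mean contributes n (p - q)^2. *)

Section BoundedMeasurable.
Context {R : realType} {d : measure_display} {T : measurableType d}.
Implicit Types f g : T -> R.

(** Every function integrated below lies in this class. It is stable under ring operations,
    substitution and integrating out a variable, and integrable for every probability, so linearity
    and Fubini need no separate integrability argument. *)
Definition bmeas f : Prop :=
  measurable_fun [set: T] f /\ exists M : R, forall x, `|f x| <= M.

Lemma bmeas_cst (c : R) : bmeas (fun _ => c).
Proof. by split; [exact: measurable_cst | exists `|c|]. Qed.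

Lemma bmeasD f g : bmeas f -> bmeas g -> bmeas (fun x => f x + g x).
Proof.
move=> [mf [M hM]] [mg [N hN]]; split; first exact: measurable_funD.
by exists (M + N) => x; rewrite (le_trans (ler_normD _ _))// lerD.
Qed.

Lemma bmeasM f g : bmeas f -> bmeas g -> bmeas (fun x => f x * g x).
Proof.
move=> [mf [M hM]] [mg [N hN]]; split; first exact: measurable_funM.
by exists (M * N) => x; rewrite normrM ler_pM.
Qed.

Lemma bmeasZ (c : R) f : bmeas f -> bmeas (fun x => c * f x).
Proof. exact/bmeasM/bmeas_cst. Qed.

Lemma bmeasN f : bmeas f -> bmeas (fun x => - f x).
Proof.
move=> [mf [M hM]]; split; first exact: measurable_funN.
by exists M => x; rewrite normrN.
Qed.

Lemma bmeasB f g : bmeas f -> bmeas g -> bmeas (fun x => f x - g x).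
Proof. by move=> bf bg; apply/bmeasD/bmeasN. Qed.

Lemma bmeasX f n : bmeas f -> bmeas (fun x => f x ^+ n).
Proof.
move=> bf; elim: n => [|n IH]; first exact: bmeas_cst.
by under eq_fun do rewrite exprS; exact: bmeasM.
Qed.

Lemma bmeas_sum (I : Type) (r : seq I) (f : I -> T -> R) :
  (forall i, bmeas (f i)) -> bmeas (fun x => \sum_(i <- r) f i x).
Proof.
move=> bf; elim: r => [|i r IH].
  by under eq_fun do rewrite big_nil; exact: bmeas_cst.
by under eq_fun do rewrite big_cons; exact: bmeasD.
Qed.

Lemma bmeas_norm f : bmeas f -> bmeas (fun x => `|f x|).
Proof.
move=> [mf [M hM]]; split; first exact: measurableT_comp.
by exists M => x; rewrite normr_id.
Qed.

Lemma bmeas_bool (b : T -> bool) : measurable_fun [set: T] b ->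
  bmeas (fun x => (b x)%:R).
Proof.
move=> mb; split; last first.
  by exists 1 => x; case: (b x); rewrite ?normr1 ?normr0.
rewrite (_ : (fun x => _) = (fun x => if b x then 1 else 0)); last first.
  by apply/funext => x; case: (b x).
by apply: measurable_fun_ifT => //; exact: measurable_cst.
Qed.

Lemma bmeas_lt f g : measurable_fun [set: T] f -> measurable_fun [set: T] g ->
  bmeas (fun x => (f x < g x)%R%:R).
Proof. by move=> mf mg; apply/bmeas_bool/measurable_fun_ltr. Qed.

Lemma bmeas_le f g : measurable_fun [set: T] f -> measurable_fun [set: T] g ->
  bmeas (fun x => (f x <= g x)%R%:R).
Proof. by move=> mf mg; apply/bmeas_bool/measurable_fun_ler. Qed.

End BoundedMeasurable.

Lemma bmeas_comp {R : realType} d d' (T : measurableType d) (T' : measurableType d')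
    (h : T' -> T) (f : T -> R) :
  measurable_fun [set: T'] h -> bmeas f -> bmeas (fun x => f (h x)).
Proof.
move=> mh [mf [M hM]]; split; first exact: measurableT_comp.
by exists M.
Qed.

Section Expectation.
Context {R : realType} {d : measure_display} {T : measurableType d}.
Variable P : probability T R.
Implicit Types f g : T -> R.

Definition Ex f : R := fine (\int[P]_x (f x)%:E).

Lemma bmeas_integrable f : bmeas f -> P.-integrable setT (EFin \o f).
Proof.
move=> [mf [M hM]]; apply: measurable_bounded_integrable => //.
  exact: le_lt_trans (probability_le1 _ _) (ltry _).
exists M; split; first exact: num_real.
by move=> x Mx y _; exact: le_trans (hM y) (ltW Mx).
Qed.

Lemma ExE f : bmeas f -> (\int[P]_x (f x)%:E)%E = (Ex f)%:E.
Proof. by move=> bf; rewrite fineK//; exact/integrable_fin_num/bmeas_integrable. Qed.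

Lemma eq_Ex f g : f =1 g -> Ex f = Ex g.
Proof. by move=> fg; congr fine; apply: eq_integral => x _; rewrite fg. Qed.

Lemma Ex_cst c : Ex (fun _ => c) = c.
Proof. by rewrite /Ex integral_cst//= [P _]probability_setT mule1. Qed.

Lemma ExD f g : bmeas f -> bmeas g -> Ex (fun x => f x + g x) = Ex f + Ex g.
Proof.
move=> bf bg; rewrite /Ex.
under eq_integral do rewrite EFinD.
by rewrite integralD ?ExE//; exact: bmeas_integrable.
Qed.

Lemma ExZ c f : bmeas f -> Ex (fun x => c * f x) = c * Ex f.
Proof.
move=> bf; rewrite /Ex.
under eq_integral do rewrite EFinM.
by rewrite integralZl ?ExE//; exact: bmeas_integrable.
Qed.

Lemma ExN f : bmeas f -> Ex (fun x => - f x) = - Ex f.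
Proof.
by move=> bf; rewrite -mulN1r -ExZ//; apply: eq_Ex => x; rewrite mulN1r.
Qed.

Lemma ExB f g : bmeas f -> bmeas g -> Ex (fun x => f x - g x) = Ex f - Ex g.
Proof. by move=> bf bg; rewrite ExD ?ExN//; exact: bmeasN. Qed.

Lemma Ex_sum (I : Type) (r : seq I) (f : I -> T -> R) :
  (forall i, bmeas (f i)) ->
  Ex (fun x => \sum_(i <- r) f i x) = \sum_(i <- r) Ex (f i).
Proof.
move=> bf; elim: r => [|i r IH].
  by rewrite big_nil -[RHS](Ex_cst 0); apply: eq_Ex => x; rewrite big_nil.
rewrite big_cons -IH -ExD//; last exact: bmeas_sum.
by apply: eq_Ex => x; rewrite big_cons.
Qed.

Lemma Ex_le f g : bmeas f -> bmeas g -> (forall x, f x <= g x) -> Ex f <= Ex g.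
Proof.
move=> bf bg fg; rewrite -lee_fin -!ExE//; apply: le_integral => //.
- exact: bmeas_integrable.
- exact: bmeas_integrable.
- by move=> x _; rewrite lee_fin.
Qed.

Lemma Ex_ge0 f : (forall x, 0 <= f x) -> 0 <= Ex f.
Proof.
by move=> f0; apply/fine_ge0/integral_ge0 => x _; rewrite lee_fin.
Qed.

Lemma Ex_le_cst f c : bmeas f -> (forall x, f x <= c) -> Ex f <= c.
Proof. by move=> bf fc; rewrite -[leRHS]Ex_cst; apply: Ex_le => //; exact: bmeas_cst. Qed.

Lemma Ex_norm_le f : bmeas f -> `|Ex f| <= Ex (fun x => `|f x|).
Proof.
move=> bf; have bn := bmeas_norm bf.
rewrite ler_norml -ExN//; apply/andP; split; apply: Ex_le => //.
- exact: bmeasN.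
- by move=> x; rewrite lerNl -normrN ler_norm.
- by move=> x; rewrite ler_norm.
Qed.

Lemma Ex_CauchySchwarz f g : bmeas f -> bmeas g ->
  Ex (fun x => f x * g x) ^+ 2 <= Ex (fun x => f x ^+ 2) * Ex (fun x => g x ^+ 2).
Proof.
move=> bf bg.
set B := Ex _; set A := Ex (fun x => f x ^+ 2); set C := Ex (fun x => g x ^+ 2).
have A0 : 0 <= A by apply: Ex_ge0 => x; exact: sqr_ge0.
have C0 : 0 <= C by apply: Ex_ge0 => x; exact: sqr_ge0.
have q (t : R) : 0 <= A + t * (- 2 * B) + t ^+ 2 * C.
  rewrite -(ExZ (-2))//; last exact: bmeasM.
  rewrite -ExZ; last exact/bmeasZ/bmeasM.
  rewrite -ExZ; last exact: bmeasX.
  rewrite -ExD; [|exact: bmeasX|exact/bmeasZ/bmeasZ/bmeasM].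
  rewrite -ExD; first last.
  - exact/bmeasZ/bmeasX.
  - by apply: bmeasD; [exact: bmeasX|exact/bmeasZ/bmeasZ/bmeasM].
  apply: Ex_ge0 => x.
  have -> : f x ^+ 2 + t * (- 2 * (f x * g x)) + t ^+ 2 * g x ^+ 2
            = (f x - t * g x) ^+ 2 by ring.
  exact: sqr_ge0.
have [C1|C1] := ltP 0 C; last first.
  have {}C0 : C = 0 by apply: le_anti; rewrite C1.
  have [->|B0] := eqVneq B 0; first by rewrite expr0n/= C0 mulr0.
  (* When [C = 0] the nonnegative quadratic in [t] is affine; at this point it would equal -1. *)
  have := q ((A + 1) / (2 * B)); rewrite C0 mulr0 addr0.
  have -> : A + (A + 1) / (2 * B) * (-2 * B) = -1 by field.
  by rewrite ler0N1.
have := q (B / C).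
have -> : A + B / C * (- 2 * B) + (B / C) ^+ 2 * C = A - B ^+ 2 / C.
  by field; rewrite gt_eqF.
by rewrite subr_ge0 ler_pdivrMr.
Qed.

Lemma Ex_sqr_le f : bmeas f -> Ex f ^+ 2 <= Ex (fun x => f x ^+ 2).
Proof.
move=> bf; have := Ex_CauchySchwarz bf (bmeas_cst 1).
rewrite (@eq_Ex (fun x => f x * 1) f); last by move=> x; rewrite mulr1.
by rewrite expr1n Ex_cst mulr1.
Qed.

Lemma Ex_markov f t : bmeas f -> (forall x, 0 <= f x) -> 0 < t ->
  Ex (fun x => (t < f x)%R%:R) <= Ex f / t.
Proof.
move=> bf f0 t0; rewrite mulrC -ExZ//.
apply: Ex_le; [|exact: bmeasZ|move=> x].
- by apply: bmeas_lt; [exact: measurable_cst|case: bf].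
- case: ltP => [tf|_]; last by rewrite mulr_ge0// invr_ge0 ltW.
  by rewrite mulrC ler_pdivlMr// mul1r ltW.
Qed.

End Expectation.

(** * Iterated expectations *)

Section Fubini.
Context {R : realType} {d1 d2 : measure_display}.
Context {T1 : measurableType d1} {T2 : measurableType d2}.
Variables (P : probability T1 R) (Q : probability T2 R).

Lemma bmeas_section1 (f : T1 * T2 -> R) x : bmeas f -> bmeas (fun y => f (x, y)).
Proof. by move=> bf; apply: bmeas_comp bf; apply: measurable_fun_pair. Qed.

Lemma bmeas_section2 (f : T1 * T2 -> R) y : bmeas f -> bmeas (fun x => f (x, y)).
Proof. by move=> bf; apply: bmeas_comp bf; apply: measurable_fun_pair. Qed.

Lemma bmeas_Ex (f : T1 * T2 -> R) : bmeas f ->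
  bmeas (fun x => Ex Q (fun y => f (x, y))).
Proof.
move=> bf; have bfx x := bmeas_section1 x bf.
(* Measurability of the partial integral is obtained through integrability for a product measure;
   any probability on the first factor serves, here a Dirac mass. *)
pose P0 : probability T1 R := \d_point.
have int : (P0 \x Q)%E.-integrable setT (EFin \o f).
  exact: (@bmeas_integrable _ _ _ (P0 \x Q)%E).
have mF := measurable_fubini_F int.
split; last first.
  have [_ [M hM]] := bf; exists M => x.
  rewrite (le_trans (Ex_norm_le _ (bfx x)))//.
  by apply: Ex_le_cst => //; exact: bmeas_norm.
apply/measurable_EFinP; apply: eq_measurable_fun mF => x _ /=.
by rewrite /fubini_F /= ExE.
Qed.

Definition prodP : probability (T1 * T2)%type R := (P \x Q)%E.

Lemma Ex_prod (f : T1 * T2 -> R) : bmeas f ->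
  Ex prodP f = Ex P (fun x => Ex Q (fun y => f (x, y))).
Proof.
move=> bf; have int := bmeas_integrable prodP bf.
rewrite {1}/Ex -[X in fine X](integral12_prod_meas1 int).
by congr fine; apply: eq_integral => x _; rewrite /fubini_F /= ExE//; exact: bmeas_section1.
Qed.

Lemma Ex_swap (f : T1 * T2 -> R) : bmeas f ->
  Ex P (fun x => Ex Q (fun y => f (x, y))) =
  Ex Q (fun y => Ex P (fun x => f (x, y))).
Proof.
move=> bf; rewrite -Ex_prod//; have int := bmeas_integrable prodP bf.
rewrite {1}/Ex -[X in fine X](integral21_prod_meas1 int).
by congr fine; apply: eq_integral => x _; rewrite /fubini_G /= ExE//; exact: bmeas_section2.
Qed.

End Fubini.

(** * Independent samples *)

Section Samples.
Context {R : realType}.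
Let RT := measurableTypeR R.
Implicit Types (P Q : probability RT R) (f g w : R -> R).

(** The n-fold product is built from nested pairs, following the recursion of [iid_int], so every
    fact about samples goes by induction with one use of Fubini. The display changes with [n] and is
    computed alongside the type. *)
Fixpoint powd (n : nat) : measure_display :=
  match n with
  | 0 => default_measure_display
  | m.+1 => measure_prod_display (sigma_display (R.-ocitv.-measurable), powd m)
  end.

Fixpoint powT (n : nat) : measurableType (powd n) :=
  match n with
  | 0 => unit
  | m.+1 => (RT * powT m)%type
  end.

Fixpoint powP P (n : nat) : probability (powT n) R :=
  match n with
  | 0 => \d_tt : probability _ _
  | m.+1 => prodP P (powP P m)
  end.

Fixpoint psum (n : nat) g : powT n -> R :=
  match n with
  | 0 => fun _ => 0
  | m.+1 => fun s => g s.1 + psum g s.2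
  end.

Fixpoint pprod (n : nat) g : powT n -> R :=
  match n with
  | 0 => fun _ => 1
  | m.+1 => fun s => g s.1 * pprod g s.2
  end.

Fixpoint pmap (n : nat) (K : R -> R) : powT n -> powT n :=
  match n with
  | 0 => fun s => s
  | m.+1 => fun s => (K s.1, pmap K s.2)
  end.

Fixpoint pseq (n : nat) : powT n -> seq R :=
  match n with
  | 0 => fun _ => [::]
  | m.+1 => fun s => s.1 :: pseq s.2
  end.

Lemma bmeas_fst d1 d2 (T1 : measurableType d1) (T2 : measurableType d2)
    (f : T1 -> R) : bmeas f -> bmeas (fun z : T1 * T2 => f z.1).
Proof. by apply: bmeas_comp; exact: measurable_fst. Qed.

Lemma bmeas_snd d1 d2 (T1 : measurableType d1) (T2 : measurableType d2)
    (f : T2 -> R) : bmeas f -> bmeas (fun z : T1 * T2 => f z.2).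
Proof. by apply: bmeas_comp; exact: measurable_snd. Qed.

Lemma bmeas_psum_param d (T : measurableType d) n (g : T * RT -> R) : bmeas g ->
  bmeas (fun z : powT n * T => psum (fun u => g (z.2, u)) z.1).
Proof.
move=> bg; elim: n => [|n IH] /=; first exact: bmeas_cst.
apply: bmeasD.
  apply: (bmeas_comp _ bg); apply: measurable_fun_pair => //.
  by apply: measurableT_comp => //; exact: measurable_fst.
pose h (z : (RT * powT n) * T) := (z.1.2, z.2).
have mh : measurable_fun setT h.
  by apply: measurable_fun_pair => //; apply: measurableT_comp.
exact: (bmeas_comp mh IH).
Qed.

Lemma bmeas_psum n g : @bmeas R _ RT g -> bmeas (@psum n g).
Proof.
move=> bg; elim: n => [|n IH] /=; first exact: bmeas_cst.
by apply: bmeasD; [exact: bmeas_fst|exact: bmeas_snd].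
Qed.

Lemma bmeas_pprod n g : @bmeas R _ RT g -> bmeas (@pprod n g).
Proof.
move=> bg; elim: n => [|n IH] /=; first exact: bmeas_cst.
by apply: bmeasM; [exact: bmeas_fst|exact: bmeas_snd].
Qed.

Lemma measurable_pmap n (K : RT -> RT) : measurable_fun setT K ->
  measurable_fun setT (@pmap n K).
Proof.
move=> mK; elim: n => [|n IH] //=.
by apply: measurable_fun_pair; apply: measurableT_comp.
Qed.

Lemma eq_psum n f g : f =1 g -> @psum n f =1 psum g.
Proof. by move=> fg; elim: n => [|n IH] s //=; rewrite fg IH. Qed.

Lemma psumD n f g s : @psum n (fun u => f u + g u) s = psum f s + psum g s.
Proof.
by elim: n s => [|n IH] s /=; [rewrite addr0|rewrite IH addrACA].
Qed.

Lemma psumN n f s : @psum n (fun u => - f u) s = - psum f s.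
Proof. by elim: n s => [|n IH] s /=; [rewrite oppr0|rewrite IH opprD]. Qed.

Lemma psumB n f g s : @psum n (fun u => f u - g u) s = psum f s - psum g s.
Proof. by rewrite psumD psumN. Qed.

Lemma psum_cst n (c : R) s : @psum n (fun=> c) s = n%:R * c.
Proof.
by elim: n s => [|n IH] s /=; [rewrite mul0r|rewrite IH -natr1 mulrDl mul1r addrC].
Qed.

Lemma psum_pmap n g K s : @psum n g (pmap K s) = psum (fun u => g (K u)) s.
Proof. by elim: n s => [|n IH] s //=; rewrite IH. Qed.

Lemma pprod1 n s : @pprod n (fun=> 1) s = 1.
Proof. by elim: n s => [|n IH] s //=; rewrite IH mulr1. Qed.

Lemma pprodX2 n g s : @pprod n g s ^+ 2 = pprod (fun u => g u ^+ 2) s.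
Proof. by elim: n s => [|n IH] s /=; [rewrite expr1n|rewrite exprMn IH]. Qed.

Lemma size_pseq n s : size (@pseq n s) = n.
Proof. by elim: n s => [|n IH] s //=; rewrite IH. Qed.

Lemma count_pseq n (a : pred R) s :
  (count a (@pseq n s))%:R = psum (fun u => (a u)%:R) s :> R.
Proof. by elim: n s => [|n IH] s //=; rewrite natrD IH. Qed.

Lemma Ex_pow0 P (F : powT 0 -> R) : Ex (powP P 0) F = F tt.
Proof.
rewrite (@eq_Ex _ _ _ _ F (fun=> F tt)); first exact: Ex_cst.
by case.
Qed.

Lemma Ex_powS P n (F : powT n.+1 -> R) : bmeas F ->
  Ex (powP P n.+1) F = Ex P (fun x => Ex (powP P n) (fun s => F (x, s))).
Proof. exact: Ex_prod. Qed.

Lemma Ex_indep P n f (F : powT n -> R) : @bmeas R _ RT f -> bmeas F ->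
  Ex (powP P n.+1) (fun s => f s.1 * F s.2) = Ex P f * Ex (powP P n) F.
Proof.
move=> bf bF; rewrite Ex_powS; last first.
  by apply: bmeasM; [exact: bmeas_fst|exact: bmeas_snd].
rewrite mulrC -ExZ//; apply: eq_Ex => x /=.
by rewrite (ExZ _ (f x))// mulrC.
Qed.

Lemma iid_intE P n (g : seq R -> R) : bmeas (fun s : powT n => g (pseq s)) ->
  iid_int P n (fun s => (g s)%:E) = (Ex (powP P n) (fun s => g (pseq s)))%:E.
Proof.
elim: n g => [|n IH] g bg /=; first by rewrite Ex_pow0.
under eq_integral => x _.
  rewrite (IH (fun s => g (x :: s))); last exact: (bmeas_section1 x bg).
  over.
rewrite ExE; first by rewrite Ex_powS.
exact: (@bmeas_Ex _ _ _ RT (powT n) (powP P n) (fun z => g (z.1 :: pseq z.2)) bg).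
Qed.

(** A one-observation change of variables passes to samples. It serves twice: with [w = 1] and [K] a
    quantile function it moves a sample from its law to the uniform law, and with [w] a tilt it is
    the change of measure. *)
Lemma Ex_pow_map P Q n w K (F : powT n -> R) :
  @bmeas R _ RT w -> measurable_fun [set: RT] (K : RT -> RT) ->
  (forall f, @bmeas R _ RT f ->
    Ex P (fun u => w u * f u) = Ex Q (fun u => f (K u))) ->
  bmeas F ->
  Ex (powP P n) (fun s => pprod w s * F s) = Ex (powP Q n) (fun s => F (pmap K s)).
Proof.
move=> bw mK wK; elim: n F => [|n IH] F bF; first by rewrite !Ex_pow0 mul1r.
have bFx x : bmeas (fun s => F (x, s)) by exact: (bmeas_section1 x bF).
rewrite Ex_powS; last by apply: bmeasM => //; exact: (@bmeas_pprod n.+1).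
rewrite Ex_powS; last by apply: bmeas_comp bF; exact: (@measurable_pmap n.+1).
transitivity (Ex P (fun x => w x * Ex (powP Q n) (fun s => F (x, pmap K s)))).
  apply: eq_Ex => x /=; rewrite -(IH (fun s => F (x, s)))// -ExZ; last first.
    by apply: bmeasM => //; exact: bmeas_pprod.
  by apply: eq_Ex => s; rewrite mulrA.
rewrite wK//.
apply: (@bmeas_Ex _ _ _ RT (powT n) _ (fun z => F (z.1, pmap K z.2))).
apply: bmeas_comp bF; apply: measurable_fun_pair => //.
by apply: measurableT_comp => //; exact: measurable_pmap.
Qed.

Lemma Ex_pprod P n w : @bmeas R _ RT w -> Ex (powP P n) (pprod w) = Ex P w ^+ n.
Proof.
move=> bw; elim: n => [|n IH]; first by rewrite Ex_pow0.
by rewrite exprS -IH -Ex_indep//; exact: bmeas_pprod.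
Qed.

Section Centered.
Variables (P : probability RT R) (f : R -> R).
Hypotheses (bf : @bmeas R _ RT f) (f0 : Ex P f = 0).

Let bS n := @bmeas_psum n f bf.
Let indep n i j : Ex (powP P n.+1) (fun s => f s.1 ^+ i * psum f s.2 ^+ j) =
  Ex P (fun u => f u ^+ i) * Ex (powP P n) (fun s => psum f s ^+ j).
Proof. by apply: (@Ex_indep P n (fun u => f u ^+ i) (fun s => psum f s ^+ j)); exact: bmeasX. Qed.
Let bij n i j : bmeas (fun s : powT n.+1 => f s.1 ^+ i * psum f s.2 ^+ j).
Proof.
apply: bmeasM; apply: bmeasX; first exact: (@bmeas_fst _ _ RT).
exact: (@bmeas_snd _ _ RT).
Qed.
Let f0X : Ex P (fun u => f u ^+ 1) = 0. Proof. exact: f0. Qed.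
Let X0 d (T : measurableType d) (Q : probability T R) (g : T -> R) :
  Ex Q (fun s => g s ^+ 0) = 1.
Proof. exact: Ex_cst. Qed.

Lemma Ex_psum n : Ex (powP P n) (psum f) = 0.
Proof.
elim: n => [|n IH]; first by rewrite Ex_pow0.
(* The trivial powers give every monomial the shape that [indep] factorizes. *)
rewrite (@eq_Ex _ _ _ _ _ (fun s : powT n.+1 => f s.1 ^+ 1 * psum f s.2 ^+ 0 +
  f s.1 ^+ 0 * psum f s.2 ^+ 1)); last by move=> s /=; rewrite !expr0 !expr1; ring.
rewrite ExD; [|exact: bij|exact: bij].
by rewrite !indep f0X X0 !mul0r add0r X0 mul1r.
Qed.

Lemma Ex_psum2 n : Ex (powP P n) (fun s => psum f s ^+ 2) =
  n%:R * Ex P (fun u => f u ^+ 2).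
Proof.
elim: n => [|n IH]; first by rewrite Ex_pow0 mul0r expr0n.
rewrite (@eq_Ex _ _ _ _ _ (fun s : powT n.+1 => f s.1 ^+ 2 * psum f s.2 ^+ 0 +
  f s.1 ^+ 0 * psum f s.2 ^+ 2 + 2 * (f s.1 ^+ 1 * psum f s.2 ^+ 1))); last first.
  by move=> s /=; rewrite !expr0 !expr1; ring.
rewrite !ExD ?(ExZ _ 2)//; do ?[exact: bij|apply: bmeasD|apply: bmeasZ].
by rewrite !indep f0X !X0 IH -natr1; ring.
Qed.

(** In the binomial expansion the terms with a first power vanish by centering; the induction closes
    because 3 n^2 + 6 n + 1 is at most 3 (n + 1)^2. *)
Lemma Ex_psum4 n : (forall u, `|f u| <= 1) ->
  Ex (powP P n) (fun s => psum f s ^+ 4) <= 3 * n%:R ^+ 2.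
Proof.
move=> f1; elim: n => [|n IH]; first by rewrite Ex_pow0 !expr0n/= mulr0.
rewrite (@eq_Ex _ _ _ _ _ (fun s : powT n.+1 => f s.1 ^+ 4 * psum f s.2 ^+ 0 +
  f s.1 ^+ 0 * psum f s.2 ^+ 4 + 4 * (f s.1 ^+ 1 * psum f s.2 ^+ 3)
  + 4 * (f s.1 ^+ 3 * psum f s.2 ^+ 1) + 6 * (f s.1 ^+ 2 * psum f s.2 ^+ 2)));
  last by move=> s /=; rewrite !expr0 !expr1; ring.
rewrite !ExD ?(ExZ _ 4) ?(ExZ _ 6)//; do ?[exact: bij|apply: bmeasD|apply: bmeasZ].
rewrite !indep f0X !X0 Ex_psum2.
have -> : Ex (powP P n) (fun s => psum f s ^+ 1) = 0 by exact: Ex_psum.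
have le1 k : Ex P (fun u => f u ^+ k) <= 1.
  apply: Ex_le_cst => [|u]; first exact: bmeasX.
  by rewrite (le_trans (ler_norm _))// normrX exprn_ile1.
have f2 : 0 <= Ex P (fun u => f u ^+ 2) by apply: Ex_ge0 => u; exact: sqr_ge0.
move: (le1 2%N) (le1 4%N) IH f2; set b := Ex P _; set c := Ex P _; set a := Ex _ _.
have n0 : 0 <= n%:R :> R by exact: ler0n.
move=> b1' c1 IH b0; have bb : b * b <= 1 by rewrite mulr_ile1.
have {bb}xb : b * (n%:R * b) <= n%:R by rewrite mulrCA ler_piMr.
by rewrite -natr1 mul0r !mulr0 mulr1 mul1r !addr0; lra.
Qed.

End Centered.

End Samples.

(** * Laws on the line and the uniform law *)

Section Laws.
Context {R : realType}.
Let RT := measurableTypeR R.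
Implicit Types (P Q : probability RT R) (f : R -> R).

Lemma measure_eq_rays (m1 m2 : {measure set RT -> \bar R}) :
  (m1 setT < +oo)%E ->
  (forall x : R, m1 `]-oo, x]%classic = m2 `]-oo, x]%classic) ->
  forall A, measurable A -> m1 A = m2 A.
Proof.
move=> fin1 m12 A mA.
have fin (m : {measure set RT -> \bar R}) x : m `]-oo, x]%classic = m1 `]-oo, x]%classic ->
    (m `]-oo, x]%classic < +oo)%E.
  by move=> ->; rewrite (le_lt_trans _ fin1)// le_measure ?inE//; exact: measurable_itv.
have oc (m : {measure set RT -> \bar R}) a b : a <= b ->
    (m `]-oo, b]%classic < +oo)%E ->
    m `]a, b]%classic = (m `]-oo, b]%classic - m `]-oo, a]%classic)%E.
  move=> ab mb; have -> : `]a, b]%classic = `]-oo, b]%classic `\` `]-oo, a]%classic :> set RT.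
    by rewrite -[RHS]setCK setCD setCitvl setUC -[LHS]setCK setCitv.
  rewrite measureD//; do ?exact: measurable_itv.
  by rewrite setIidr//; exact: subset_itvl.
apply: (@measure_unique _ R RT (@ocitv R) (fun k => `]- k%:R, k%:R]%classic)) => //.
- exact: ocitvI.
- by move=> k; exact: is_ocitv.
- rewrite -subTset => x _; exists (Num.bound `|x|) => //=.
  by rewrite in_itv/=; have := archi_boundP (normr_ge0 x); rewrite ltr_norml => /andP[-> /ltW].
- move=> _ [[a b] _ <-] /=.
  have [ab|ba] := leP a b; last by rewrite set_itv_ge ?measure0// bnd_simp -leNgt ltW.
  rewrite !oc//; first by rewrite !m12.
  - exact: fin.
  - exact: fin.
- by move=> k; rewrite (le_lt_trans _ fin1)// le_measure ?inE//; exact: measurable_itv.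
Qed.

Lemma ge0_integral_mrestr d (T : measurableType d) (m : {measure set T -> \bar R})
    (D : set T) (mD : measurable D) (f : T -> \bar R) :
  measurable_fun setT f -> (forall x, 0 <= f x)%E ->
  (\int[mrestr m mD]_x f x = \int[m]_(x in D) f x)%E.
Proof.
move=> mf f0; rewrite -(setUv D) ge0_integral_setU //; first last.
- exact/disj_set2P/subsets_disjoint.
- by rewrite setUv.
- exact: measurableC.
rewrite (@eq_measure_integral _ _ _ D m); last first.
  by move=> A mA AD; rewrite /= /mrestr setIidl.
rewrite [X in (_ + X)%E](@eq_measure_integral _ _ _ (~` D) mzero); last first.
  move=> A mA AD; rewrite /= /mrestr /mzero.
  by rewrite (_ : A `&` D = set0) ?measure0//; apply/disjoints_subset.
by rewrite integral_measure_zero adde0.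
Qed.

Lemma distr_funE P x : P `]-oo, x]%classic = (distr_fun P x)%:E.
Proof.
by rewrite /distr_fun fineK//; apply: fin_num_measure; exact: measurable_itv.
Qed.

Lemma Ex_ray P x : Ex P (fun u : RT => (u <= x)%R%:R) = distr_fun P x.
Proof.
rewrite /Ex /distr_fun; congr fine.
rewrite -[in RHS](setIT `]-oo, x]%classic) -integral_indic; [|exact: measurableT|exact: measurable_itv].
by apply: eq_integral => u _; rewrite indicE mem_setE in_itv.
Qed.

Lemma bmeas_ray x : @bmeas R _ RT (fun u : RT => (u <= x)%R%:R).
Proof. by apply: bmeas_le; [exact: measurable_id|exact: measurable_cst]. Qed.

(** Transport of integrals is first proved for nonnegative functions; adding a constant extends it
    to all bounded ones. *)
Lemma bmeas_nonneg_shift d (T : measurableType d) (f : T -> R) : bmeas f ->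
  exists2 M : R, forall x, 0 <= f x + M & bmeas (fun x => f x + M).
Proof.
move=> bf; have [_ [M hM]] := bf; exists M.
  by move=> x; have := hM x; rewrite ler_norml => /andP[]; lra.
by apply: bmeasD => //; exact: bmeas_cst.
Qed.

Lemma Ex_law d (T : measurableType d) P (Q : probability T R) (X : T -> R) f :
  measurable_fun [set: T] (X : T -> RT) ->
  (forall x, distr_fun P x = Ex Q (fun t => (X t <= x)%R%:R)) ->
  @bmeas R _ RT f -> Ex P f = Ex Q (fun t => f (X t)).
Proof.
move=> mX PX bf.
have bX g : @bmeas R _ RT g -> bmeas (fun t => g (X t)).
  exact: (bmeas_comp mX).
pose mX' := isMeasurableFun.Build _ _ T RT X mX.
pose Xm : {mfun T >-> RT} := HB.pack (X : T -> RT) mX'.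
have law A : measurable A -> P A = pushforward Q Xm A.
  apply: measure_eq_rays; first exact: le_lt_trans (probability_le1 P measurableT) (ltry 1).
  move=> x; rewrite /pushforward; transitivity (distr_fun P x)%:E.
    exact: distr_funE.
  rewrite PX -ExE; last exact: (bX _ (bmeas_ray x)).
  rewrite -[X in _ = Q X]setIT -integral_indic; [|exact: measurableT|]; last first.
    have := mX measurableT _ (measurable_itv `]-oo, x]); by rewrite setTI.
  apply: eq_integral => t _; rewrite indicE; congr ((nat_of_bool _)%:R)%:E.
  by apply/idP/idP; rewrite inE /= in_itv.
have nn g : @bmeas R _ RT g -> (forall x, 0 <= g x) -> Ex P g = Ex Q (fun t => g (X t)).
  move=> bg g0; congr fine.
  rewrite (@eq_measure_integral _ _ _ _ (pushforward Q Xm)); last by move=> A mA _; exact: law.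
  have mg : measurable_fun [set: RT] (EFin \o g) by apply/measurable_EFinP; case: bg.
  by rewrite (ge0_integral_pushforward mX)//= => x _; rewrite lee_fin.
have [M h0 bM] := bmeas_nonneg_shift bf.
have := nn _ bM h0; rewrite !ExD//; do ?exact: bmeas_cst; last exact: bX.
by rewrite !Ex_cst => /addIr.
Qed.

Lemma F0_le0 (x : R) : x <= 0 -> F0 x = 0.
Proof. by move=> x0; rewrite /F0 (max_idPr x0) min_l. Qed.

Lemma F0_ge1 (x : R) : 1 <= x -> F0 x = 1.
Proof. by move=> x1; rewrite /F0 max_l ?min_r//; lra. Qed.

Lemma F0_id (x : R) : 0 <= x <= 1 -> F0 x = x.
Proof. by move=> /andP[x0 x1]; rewrite /F0 max_l// min_l. Qed.

Lemma F0_01 (x : R) : 0 <= F0 x <= 1.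
Proof. by rewrite /F0 le_min ge_min le_max !lexx ler01 !orbT. Qed.

Lemma measurable_F0 : measurable_fun [set: RT] (@F0 R : RT -> RT).
Proof.
apply: measurable_minr; last exact: measurable_cst.
by apply: measurable_maxr; [exact: measurable_id|exact: measurable_cst].
Qed.

Lemma integral01_Unif (g : RT -> R) : @bmeas R _ RT g -> (forall x, 0 <= g x) ->
  fine (\int[@lebesgue_measure R]_(x in `[0, 1]%classic) (g x)%:E) = Ex (@Unif R) g.
Proof.
move=> [mg _] g0; rewrite /Ex /Unif integral_uniform.
- by rewrite subr0 invr1 mul1e.
- exact/measurable_EFinP.
- by move=> x; rewrite lee_fin.
Qed.

Lemma distr_Unif x : distr_fun (@Unif R) x = F0 x.
Proof.
rewrite -Ex_ray -integral01_Unif; [|exact: bmeas_ray|by move=> u; exact: ler0n].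
have -> : (\int[@lebesgue_measure R]_(u in `[0%R, 1%R]%classic) ((u <= x)%R%:R)%:E)%E =
    lebesgue_measure (`]-oo, x]%classic `&` `[0, 1]%classic : set RT).
  rewrite -integral_indic; do ?exact: measurable_itv.
  by apply: eq_integral => u _; rewrite indicE mem_setE in_itv.
have [x0|x0] := ltP x 0.
  rewrite F0_le0 ?(ltW x0)// (_ : _ `&` _ = set0) ?measure0//.
  rewrite -subset0 => u /=; rewrite !in_itv/= => -[ux /andP[u0 _]]; lra.
have [x1|x1] := leP x 1.
  rewrite F0_id ?x0// (_ : _ `&` _ = `[0, x]%classic).
    by rewrite lebesgue_measure_itv/= lte_fin; case: ltP => /= [|?]; rewrite ?subr0//; lra.
  apply/seteqP; split => u /=; rewrite !in_itv/=.
    by move=> [-> /andP[-> _]].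
  by move=> /andP[-> ux]; rewrite ux (le_trans ux).
rewrite F0_ge1 ?(ltW x1)// (_ : _ `&` _ = `[0, 1]%classic).
  by rewrite lebesgue_measure_itv/= lte_fin ltr01/= subr0.
apply/seteqP; split => u /=; rewrite !in_itv/=; first by move=> [_ ->].
by move=> /andP[-> u1]; rewrite u1 (le_trans u1 (ltW x1)).
Qed.

Lemma Ex_Unif_ray x : Ex (@Unif R) (fun u : RT => (u <= x)%R%:R) = F0 x.
Proof. by rewrite Ex_ray distr_Unif. Qed.

(* The density [1 + th] on [[0, 1/2]] and [1 - th] on [[1/2, 1]]; its law is that of
   [tilt_map th] under the uniform law. *)
Definition tilt (th : R) (u : R) : R := 1 - th + (2 * th) * (u <= 2^-1)%R%:R.

(** The inverse of [tilt_cdf th]: that function is the minimum of the increasing lines (1 + th) x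
    and (1 - th) x + th, so its inverse is the maximum of their inverses. *)
Definition tilt_map (th : R) (v : R) : R := Num.max (v / (1 + th)) ((v - th) / (1 - th)).

Definition tilt_cdf (th : R) (x : R) : R := x + th * Num.min x (1 - x).

Lemma tilt_map_le th v x : 0 <= th < 1 -> (tilt_map th v <= x) = (v <= tilt_cdf th x).
Proof.
move=> /andP[t0 t1]; rewrite /tilt_map /tilt_cdf ge_max.
rewrite ler_pdivrMr ?ler_pdivrMr; do ?lra.
case: (leP x (1 - x)) => h; apply/andP/idP => [[h1 h2]|h1]; try split; nra.
Qed.

Lemma measurable_tilt_map th : measurable_fun [set: RT] (tilt_map th : RT -> RT).
Proof.
apply: measurable_maxr; apply: measurable_funM => //; do ?exact: measurable_cst.
by apply: measurable_funB => //; exact: measurable_cst.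
Qed.

Lemma bmeas_tilt th : @bmeas R _ RT (tilt th).
Proof. by apply: bmeasD; [exact: bmeas_cst|exact/bmeasZ/bmeas_ray]. Qed.

(** Two computations of the mass that the tilted law gives to the ray up to [x]: on the left through
    [tilt_map], on the right through the density. *)
Lemma F0_tilt_cdf th x : 0 <= th < 1 ->
  F0 (tilt_cdf th x) = (1 - th) * F0 x + 2 * th * F0 (Num.min x 2^-1).
Proof.
move=> /andP[t0 t1]; rewrite /tilt_cdf.
have [x0|x0] := leP x 0.
  rewrite (@min_l _ _ x (1 - x)) ?(@min_l _ _ x 2^-1); do ?lra.
  rewrite !F0_le0//; first by rewrite !mulr0 addr0.
  by nra.
have [x1|x1] := leP x 2^-1.
  rewrite min_l; last by lra.
  rewrite !F0_id; [by ring|lra|nra].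
have [x2|x2] := leP x 1.
  rewrite min_r; last by lra.
  rewrite !F0_id; [by field|lra|lra|nra].
rewrite min_r; last by lra.
rewrite (@F0_ge1 x) ?(@F0_id 2^-1) ?F0_ge1; [by field|nra|lra|lra].
Qed.

Lemma Ex_tilt th f : 0 <= th < 1 -> @bmeas R _ RT f ->
  Ex (@Unif R) (fun u => tilt th u * f u) = Ex (@Unif R) (fun u => f (tilt_map th u)).
Proof.
move=> tP; have /andP[t0 t1] := tP => bf.
pose U := @Unif R; have mD : measurable (`]-oo, 2^-1]%classic : set RT) by exact: measurable_itv.
have a0 : 0 <= 1 - th by lra.
have b0 : 0 <= 2 * th by lra.
(* The measure with density [tilt th], written as a multiple of the uniform law plus a multiple of
   its restriction to the left half, so that its values on rays are explicit. *)
pose m1 : {measure set RT -> \bar R} :=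
  measure_add (mscale (NngNum a0) U) (mscale (NngNum b0) (mrestr U mD)).
have mT := measurable_tilt_map th.
pose mT' := isMeasurableFun.Build _ _ RT RT (tilt_map th) mT.
pose Tm : {mfun RT >-> RT} := HB.pack (tilt_map th : RT -> RT) mT'.
pose m2 := pushforward U Tm.
have UE x : U `]-oo, x]%classic = (F0 x)%:E.
  by rewrite -distr_Unif; exact: distr_funE.
have m1E A : m1 A = ((1 - th)%:E * U A + (2 * th)%:E * U (A `&` `]-oo, 2^-1%R]%classic))%E.
  exact: measure_addE.
have law A : measurable A -> m1 A = m2 A.
  apply: measure_eq_rays => [|x]; rewrite m1E.
    by rewrite setTI UE probability_setT -!EFinM -EFinD ltry.
  rewrite /m2 /pushforward.
  have -> : `]-oo, x]%classic `&` `]-oo, 2^-1]%classic = `]-oo, Num.min x 2^-1]%classic :> set RT.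
    by apply/seteqP; split => u /=; rewrite !in_itv/= le_min => /andP.
  have pre : Tm @^-1` `]-oo, x]%classic = `]-oo, tilt_cdf th x]%classic :> set RT.
    by apply/seteqP; split => u /=; rewrite !in_itv/= tilt_map_le.
  transitivity (F0 (tilt_cdf th x))%:E; first by rewrite !UE -!EFinM -EFinD F0_tilt_cdf.
  by rewrite -UE -pre.
have bwg g : @bmeas R _ RT g -> @bmeas R _ RT (fun u => tilt th u * g u).
  by move=> bg; apply: bmeasM => //; exact: bmeas_tilt.
have nn g : @bmeas R _ RT g -> (forall x, 0 <= g x) ->
    Ex U (fun u => tilt th u * g u) = Ex U (fun u => g (tilt_map th u)).
  move=> bg g0; have mg : measurable_fun [set: RT] (EFin \o g).
    by apply/measurable_EFinP; case: bg.
  have g0' x : (0 <= (EFin \o g) x)%E by rewrite lee_fin.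
  transitivity (fine (\int[m2]_x (EFin \o g) x)); last first.
    by congr fine; rewrite (ge0_integral_pushforward mT).
  transitivity (fine (\int[m1]_x (EFin \o g) x)); last first.
    by congr fine; apply: eq_measure_integral => A mA _; exact: law.
  rewrite ge0_integral_measure_add// !ge0_integral_mscale//.
  have bh : @bmeas R _ RT (fun u : RT => (u <= 2^-1)%R%:R * g u).
    by apply: bmeasM => //; exact: bmeas_ray.
  have -> : (\int[mrestr U mD]_x (EFin \o g) x)%E =
      (Ex U (fun u : RT => (u <= 2^-1)%R%:R * g u))%:E.
    rewrite ge0_integral_mrestr// integral_mkcond -ExE//; apply: eq_integral => u _.
    rewrite patchE mem_setE in_itv/=.
    by case: (u <= _); rewrite ?mul1r ?mul0r.
  rewrite [X in ((_ * X) + _)%E](ExE U bg) /= -(ExZ U (1 - th))// -(ExZ U (2 * th))// -ExD.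
  - by apply: eq_Ex => u; rewrite /tilt; ring.
  - exact: bmeasZ.
  - exact: bmeasZ.
have [M h0 bM] := bmeas_nonneg_shift bf.
have := nn _ bM h0.
rewrite (@eq_Ex _ _ _ U _ (fun u => tilt th u * f u + M * (tilt th u * 1))); last first.
  by move=> u; ring.
rewrite !ExD ?(ExZ _ M)//; do ?[exact: bmeas_cst|exact: bwg|exact/bmeasZ/bwg/bmeas_cst].
  rewrite (nn (fun=> 1))//; last exact: bmeas_cst.
  by rewrite !Ex_cst mulr1 => /addIr.
  exact/(bwg (fun=> 1))/bmeas_cst.
exact: (bmeas_comp mT bf).
Qed.

End Laws.

(** * The quantile representation of the statistic *)

Section Quantile.
Context {R : realType}.
Let RT := measurableTypeR R.
Variable P : probability RT R.
Let F := distr_fun P.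

Lemma distr_fun_le : {homo F : x y / x <= y}.
Proof.
move=> x y xy; rewrite /F -!Ex_ray; apply: Ex_le; do ?exact: bmeas_ray.
by move=> u; rewrite ler_nat; case: leP => // ux; rewrite (le_trans ux xy).
Qed.

Lemma distr_fun_01 x : 0 <= F x <= 1.
Proof.
rewrite /F -Ex_ray; apply/andP; split; first by apply: Ex_ge0 => u; exact: ler0n.
by apply: Ex_le_cst => [|u]; [exact: bmeas_ray|rewrite lern1 leq_b1].
Qed.

Lemma measurable_distr_fun : measurable_fun [set: RT] (F : RT -> RT).
Proof. by apply: nondecreasing_measurable => // x y; exact: distr_fun_le. Qed.

(** The form of right continuity that makes the infimum in [quantile] attained. *)
Lemma distr_fun_right_limit x y : (forall z, x < z -> y <= F z) -> y <= F x.
Proof.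
move=> h; pose idTR : RT -> R := idfun.
pose mid := isMeasurableFun.Build _ _ RT _ idTR (@measurable_id _ _ setT).
pose X : {RV P >-> R} := HB.pack idTR mid.
have rc : F @ x^'+ --> F x.
  apply: fine_cvg; rewrite fineK; last by apply: fin_num_measure; exact: measurable_itv.
  exact: (@cdf_right_continuous _ _ _ P X x).
by apply: (cvgr_to_ge rc); near=> z; apply: h; near: z; exact: nbhs_right_gt.
Unshelve. all: by end_near. Qed.

Hypothesis P01 : on01 P.

Lemma distr_fun_lt0 x : x < 0 -> F x = 0.
Proof.
move=> x0; apply: le_anti; rewrite (andP (distr_fun_01 x)).1 andbT -lee_fin.
have <- : P `]-oo, x]%classic = (F x)%:E by exact: distr_funE.
have m01 : measurable (`[0, 1]%classic : set RT) by exact: measurable_itv.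
have <- : P (~` `[0, 1]%classic) = 0%:E by rewrite probability_setC// P01 subee.
apply: le_measure; rewrite ?inE; [exact: measurable_itv|exact: measurableC|].
by move=> u /=; rewrite !in_itv/= => ux /andP[]; lra.
Qed.

Lemma distr_fun_ge1 x : 1 <= x -> F x = 1.
Proof.
move=> x1; apply: le_anti; rewrite (andP (distr_fun_01 x)).2 /= -lee_fin.
have <- : P `]-oo, x]%classic = (F x)%:E by exact: distr_funE.
rewrite -P01; apply: le_measure; rewrite ?inE; do ?exact: measurable_itv.
by move=> u /=; rewrite !in_itv/= => /andP[_ u1]; exact: le_trans x1.
Qed.

(* The value [2] for [1 < u] makes [quantile_le] valid for every real [u]. *)
Definition quantile (u : R) : R :=
  if u <= 1 then inf [set x : R | 0 <= x <= 1 /\ u <= F x] else 2.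

Let A u := [set x : R | 0 <= x <= 1 /\ u <= F x].
Let A1 u : u <= 1 -> A u 1.
Proof. by move=> u1; split; rewrite ?ler01 ?lexx// distr_fun_ge1. Qed.
Let lbA u : has_lbound (A u).
Proof. by exists 0 => x [/andP[]]. Qed.

Lemma quantile_ge0 u : 0 <= quantile u.
Proof.
rewrite /quantile; case: ifPn => // u1.
by apply: lb_le_inf; [exists 1; exact: A1|move=> x [/andP[]]].
Qed.

Lemma quantile_le1 u : u <= 1 -> quantile u <= 1.
Proof. by move=> u1; rewrite /quantile u1; apply: ge_inf (A1 u1); exact: lbA. Qed.

Lemma quantile_le u t : 0 <= t <= 1 -> (quantile u <= t) = (u <= F t).
Proof.
move=> t01; have [u1|u1] := leP u 1; last first.
  rewrite /quantile (leNgt u 1) u1 /=; have /andP[_ F1] := distr_fun_01 t.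
  by apply/idP/idP => h; move: t01 => /andP[? ?]; lra.
rewrite /quantile u1; apply/idP/idP => [it|ut]; last first.
  by apply: ge_inf; [exact: lbA|split].
apply: distr_fun_right_limit => z tz.
have iA : has_inf (A u) by split; [exists 1; exact: A1|exact: lbA].
have z0 : 0 < z - inf (A u) by rewrite subr_gt0 (le_lt_trans it).
have [x [_ ux] xz] := inf_adherent z0 iA.
by rewrite (le_trans ux)// distr_fun_le//; move: xz; rewrite addrCA subrr addr0 => /ltW.
Qed.

Lemma quantile_homo : {homo quantile : x y / x <= y}.
Proof.
move=> x y xy; have [y1|y1] := leP y 1; last first.
  rewrite {2}/quantile (leNgt y 1) y1 /=; have [x1|x1] := leP x 1.
    by rewrite (le_trans (quantile_le1 x1))// ler1n.
  by rewrite /quantile (leNgt x 1) x1.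
by rewrite quantile_le ?(le_trans xy)// -?quantile_le// quantile_ge0 quantile_le1.
Qed.

Lemma measurable_quantile : measurable_fun [set: RT] (quantile : RT -> RT).
Proof. by apply: nondecreasing_measurable => // x y; exact: quantile_homo. Qed.

Lemma quantile_law x :
  F x = Ex (@Unif R) (fun u : RT => (quantile u <= x)%R%:R).
Proof.
have [x0|x0] := ltP x 0.
  rewrite distr_fun_lt0// -[LHS](Ex_cst (@Unif R)); apply: eq_Ex => u.
  by rewrite leNgt (lt_le_trans x0 (quantile_ge0 u)).
have [x1|x1] := leP x 1.
  rewrite -[LHS]F0_id; last exact: distr_fun_01.
  by rewrite -Ex_Unif_ray; apply: eq_Ex => u; rewrite quantile_le// x0.
have bq : @bmeas R _ RT (fun u : RT => (quantile u <= x)%R%:R).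
  by apply: bmeas_le; [exact: measurable_quantile|exact: measurable_cst].
rewrite distr_fun_ge1 ?(ltW x1)//; apply: le_anti; apply/andP; split.
  rewrite -[leLHS](@F0_ge1 R 1)// -Ex_Unif_ray; apply: Ex_le => // [|u].
    exact: bmeas_ray.
  rewrite ler_nat; case: leP => // u1.
  by rewrite (le_trans (quantile_le1 u1) (ltW x1)).
by apply: Ex_le_cst => // u; rewrite lern1 leq_b1.
Qed.

End Quantile.

Section Statistic.
Context {R : realType}.
Let RT := measurableTypeR R.
Implicit Types (p q : R -> R).

(** When [p] is the distribution function of a law on [0, 1] and [t] lies in [0, 1], the event
    [u <= p t] says that the quantile of [u] is at most [t]. So this is n times the empirical minus
    the null distribution function of the transformed sample. *)
Definition dev p n (s : powT n) (t : R) : R :=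
  psum (fun u => (u <= p t)%R%:R - F0 t) s.

Definition sq_stat p n (s : powT n) : R :=
  Ex (@Unif R) (fun t => dev p s t ^+ 2) / n%:R.

Definition mcdf p := measurable_fun [set: RT] (p : RT -> RT).

Lemma bmeas_F0 : @bmeas R _ RT (@F0 R).
Proof.
split; first exact: measurable_F0.
by exists 1 => x; have /andP[? ?] := F0_01 x; rewrite ger0_norm.
Qed.

Lemma bmeas_dev_joint p n : mcdf p ->
  bmeas (fun z : powT n * RT => dev p z.1 z.2).
Proof.
move=> mp; apply: (@bmeas_psum_param R _ RT n (fun z => (z.2 <= p z.1)%R%:R - F0 z.1)).
apply: bmeasB.
  by apply: bmeas_le => //; apply: (measurableT_comp mp).
exact: bmeas_fst bmeas_F0.
Qed.

Lemma bmeas_dev p n (s : powT n) : mcdf p -> @bmeas R _ RT (dev p s).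
Proof. by move=> mp; exact: (bmeas_section1 s (bmeas_dev_joint n mp)). Qed.

Lemma bmeas_sq_stat p n : mcdf p -> bmeas (fun s : powT n => sq_stat p s).
Proof.
move=> mp; rewrite /sq_stat; under eq_fun do rewrite mulrC; apply: bmeasZ.
apply: (@bmeas_Ex _ _ _ (powT n) RT _ (fun z => dev p z.1 z.2 ^+ 2)).
exact/bmeasX/bmeas_dev_joint.
Qed.

Lemma sq_stat_ge0 p n (s : powT n) : 0 <= sq_stat p s.
Proof. by rewrite mulr_ge0 ?invr_ge0//; apply: Ex_ge0 => t; exact: sqr_ge0. Qed.

Lemma mcdf_id : mcdf idfun.
Proof. exact: measurable_id. Qed.

Lemma cvm_statE n (s : powT n) : cvm_stat (pseq s) = sq_stat idfun s.
Proof.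
rewrite /cvm_stat /sq_stat size_pseq.
(* For the empty sample both sides are 0, since the inverse of 0 is 0. *)
case: n s => [|n] s; first by rewrite mul0r invr0 mulr0.
have E t : edf (pseq s) t - F0 t = n.+1%:R^-1 * dev idfun s t.
  rewrite /edf /dev size_pseq count_pseq psumB psum_cst /=.
  by rewrite mulrBr mulrA mulVf ?pnatr_eq0// mul1r mulrC.
have bd := bmeas_dev s mcdf_id.
rewrite /T2; under eq_integral do rewrite E.
rewrite integral01_Unif; last by move=> t; exact: sqr_ge0.
  under eq_Ex do rewrite exprMn.
  rewrite ExZ; last exact: bmeasX.
  by rewrite exprVn mulrA mulrC expr2 invfM mulVKf// pnatr_eq0.
exact/bmeasX/bmeasZ.
Qed.

Lemma rejE P n c : on01 P -> rej P n c =
  Ex (powP (@Unif R) n) (fun s => (c < sq_stat (distr_fun P) s)%R%:R).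
Proof.
move=> P01; have mq := measurable_quantile P01.
pose G (s : powT n) : R := (c < sq_stat idfun s)%R%:R.
have bG : bmeas G.
  by apply: bmeas_lt; [exact: measurable_cst|case: (bmeas_sq_stat n mcdf_id)].
have E : (fun s : powT n => ((c < cvm_stat (pseq s))%R%:R : R)) = G.
  by apply/funext => s; rewrite cvm_statE.
rewrite /rej (iid_intE P (g := fun s => (c < cvm_stat s)%R%:R)) E// /=.
(* The trivial weight brings the expectation to the form of [Ex_pow_map]. *)
transitivity (Ex (powP P n) (fun s => pprod (fun=> 1) s * G s)).
  by apply: eq_Ex => s; rewrite pprod1 mul1r.
transitivity (Ex (powP (@Unif R) n) (fun s => G (pmap (quantile P) s))).
  apply: Ex_pow_map => //; first exact: bmeas_cst.
  move=> f bf; under eq_Ex do rewrite mul1r.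
  by apply: Ex_law => //; exact: quantile_law.
apply: eq_Ex => s; rewrite /G; congr ((_ < _)%R%:R); congr (_ / _).
have b1 := bmeasX 2 (bmeas_dev (pmap (quantile P) s) mcdf_id).
have b2 := bmeasX 2 (bmeas_dev s (measurable_distr_fun P)).
(* [quantile_le] holds for [t] in [0, 1] only, hence the return to integrals over that interval. *)
rewrite -(integral01_Unif b1) -?(integral01_Unif b2); do ?by move=> t; exact: sqr_ge0.
congr fine; apply: eq_integral => t; rewrite inE/= in_itv/= => t01.
rewrite /dev psum_pmap; congr ((_ ^+ 2)%:E); apply: eq_psum => u.
by rewrite quantile_le.
Qed.

End Statistic.

(** * Moments of the statistic *)

Section Moments.
Context {R : realType}.
Let RT := measurableTypeR R.
Let U := @Unif R.
Implicit Types (p q : R -> R).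

Definition pcdf p := mcdf p /\ forall t, 0 <= p t <= 1.

Definition dist2 p q := Ex U (fun t => (p t - q t) ^+ 2).

Lemma pcdf_F0 : pcdf (@F0 R).
Proof. by split; [exact: measurable_F0|exact: F0_01]. Qed.

Lemma pcdf_distr P : pcdf (distr_fun P).
Proof. by split; [exact: measurable_distr_fun|exact: distr_fun_01]. Qed.

Lemma pcdf_bmeas p : pcdf p -> @bmeas R _ RT p.
Proof.
move=> [mp p01]; split => //; exists 1 => t.
by have /andP[? ?] := p01 t; rewrite ger0_norm.
Qed.

Lemma dist2_ge0 p q : 0 <= dist2 p q.
Proof. by apply: Ex_ge0 => t; exact: sqr_ge0. Qed.

Lemma Ex_norm_dist2 p q : pcdf p -> pcdf q ->
  Ex U (fun t => `|p t - q t|) ^+ 2 <= dist2 p q.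
Proof.
move=> /pcdf_bmeas bp /pcdf_bmeas bq.
rewrite (le_trans (Ex_sqr_le _ _))//; first exact/bmeas_norm/bmeasB.
rewrite (@eq_Ex _ _ _ U _ (fun t => (p t - q t) ^+ 2))// => t.
by rewrite -normrX ger0_norm// sqr_ge0.
Qed.

Section One.
Variables (p : R -> R) (n : nat).
Hypothesis pp : pcdf p.
Let E := Ex (powP U n).

Definition cent (s : powT n) t := psum (fun u => (u <= p t)%R%:R - p t) s.

(** Splitting [dev] at its mean leaves a random part, whose moments are bounded uniformly in [p] and
    [n], and a deterministic part measured by [drift]. *)
Definition noise (s : powT n) := Ex U (fun t => cent s t ^+ 2) / n%:R.

Definition drift := n%:R * dist2 p (@F0 R).

Lemma devE (s : powT n) t : dev p s t = cent s t + n%:R * (p t - F0 t).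
Proof. by rewrite /dev /cent -(psum_cst _ s) -psumD; apply: eq_psum => u; ring. Qed.

Lemma bmeas_cent_joint : bmeas (fun z : powT n * RT => cent z.1 z.2).
Proof.
apply: (@bmeas_psum_param R _ RT n (fun z => (z.2 <= p z.1)%R%:R - p z.1)).
have [mp _] := pp; apply: bmeasB; last exact/bmeas_fst/pcdf_bmeas.
by apply: bmeas_le => //; apply: (measurableT_comp mp).
Qed.

Lemma bmeas_cent s : @bmeas R _ RT (cent s).
Proof. exact: (bmeas_section1 s bmeas_cent_joint). Qed.

Lemma bmeas_noise : bmeas noise.
Proof.
rewrite /noise; under eq_fun do rewrite mulrC; apply: bmeasZ.
apply: (@bmeas_Ex _ _ _ (powT n) RT _ (fun z => cent z.1 z.2 ^+ 2)).
exact/bmeasX/bmeas_cent_joint.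
Qed.

Lemma noise_ge0 s : 0 <= noise s.
Proof. by rewrite mulr_ge0 ?invr_ge0//; apply: Ex_ge0 => t; exact: sqr_ge0. Qed.

Lemma drift_ge0 : 0 <= drift.
Proof. by rewrite mulr_ge0// dist2_ge0. Qed.

Let cf t : @bmeas R _ RT (fun u : RT => (u <= p t)%R%:R - p t).
Proof. by apply: bmeasB; [exact: bmeas_ray|exact: bmeas_cst]. Qed.

Let Ep t : Ex U (fun u : RT => (u <= p t)%R%:R) = p t.
Proof. by rewrite Ex_Unif_ray F0_id//; case: pp. Qed.

Let Ecf t : Ex U (fun u : RT => (u <= p t)%R%:R - p t) = 0.
Proof. by rewrite ExB ?Ep ?Ex_cst ?subrr//; [exact: bmeas_ray|exact: bmeas_cst]. Qed.

Let Ecf2 t : Ex U (fun u : RT => ((u <= p t)%R%:R - p t) ^+ 2) = p t * (1 - p t).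
Proof.
rewrite (@eq_Ex _ _ _ U _ (fun u : RT => (1 - 2 * p t) * (u <= p t)%R%:R + p t ^+ 2)).
  rewrite ExD ?ExZ ?Ep ?Ex_cst; do ?[exact/bmeasZ/bmeas_ray|exact: bmeas_ray|exact: bmeas_cst].
  by ring.
by move=> u; case: (u <= p t) => /=; ring.
Qed.

Lemma Ex_cent t : E (fun s => cent s t) = 0.
Proof. exact: Ex_psum. Qed.

Lemma Ex_cent2 t : E (fun s => cent s t ^+ 2) = n%:R * (p t * (1 - p t)).
Proof. by rewrite /E Ex_psum2// Ecf2. Qed.

Lemma Ex_cent4 t : E (fun s => cent s t ^+ 4) <= 3 * n%:R ^+ 2.
Proof.
apply: Ex_psum4 => // u; have [_ /(_ t)/andP[? ?]] := pp.
by case: (u <= p t) => /=; rewrite ler_norml; apply/andP; split; lra.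
Qed.

Let bX s k : @bmeas R _ RT (fun t => cent s t ^+ k).
Proof. exact/bmeasX/bmeas_cent. Qed.

Let swap k : E (fun s => Ex U (fun t => cent s t ^+ k)) =
  Ex U (fun t => E (fun s => cent s t ^+ k)).
Proof.
apply: (@Ex_swap _ _ _ (powT n) RT (powP U n) U (fun z => cent z.1 z.2 ^+ k)).
exact/bmeasX/bmeas_cent_joint.
Qed.

Let bswap k : bmeas (fun s => Ex U (fun t => cent s t ^+ k)).
Proof.
apply: (@bmeas_Ex _ _ _ (powT n) RT _ (fun z => cent z.1 z.2 ^+ k)).
exact/bmeasX/bmeas_cent_joint.
Qed.

Let bvar : @bmeas R _ RT (fun t => p t * (1 - p t)).
Proof.
have bp := pcdf_bmeas pp; apply: bmeasM => //; apply: bmeasB => //.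
exact: bmeas_cst.
Qed.

Let bdiff : @bmeas R _ RT (fun t => p t - F0 t).
Proof. by apply: bmeasB; apply: pcdf_bmeas => //; exact: pcdf_F0. Qed.

Hypothesis n0 : (0 < n)%N.
Let nr0 : 0 < n%:R :> R. Proof. by rewrite ltr0n. Qed.
Let nrn0 : n%:R != 0 :> R. Proof. by rewrite gt_eqF. Qed.

Lemma Ex_noise : E noise = Ex U (fun t => p t * (1 - p t)).
Proof.
rewrite /noise /E; under eq_Ex do rewrite mulrC.
rewrite ExZ ?[Ex (powP U n) _](swap 2); last exact: (bswap 2).
under eq_Ex do rewrite Ex_cent2.
by rewrite ExZ// mulKf.
Qed.

Lemma Ex_noise_le : E noise <= 4^-1.
Proof.
rewrite Ex_noise; apply: Ex_le_cst => // t.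
have : 0 <= (p t - 2^-1) ^+ 2 by exact: sqr_ge0.
by rewrite !expr2; lra.
Qed.

(** Jensen's inequality in [t] brings the square inside the integral, where the fourth moment of
    [cent] is known. *)
Lemma Ex_noise2_le : E (fun s => noise s ^+ 2) <= 3.
Proof.
have h : E (fun s => Ex U (fun t => cent s t ^+ 4)) <= 3 * n%:R ^+ 2.
  rewrite swap; apply: Ex_le_cst => [|t]; last exact: Ex_cent4.
  apply: (@bmeas_Ex _ _ _ RT (powT n) _ (fun z => cent z.2 z.1 ^+ 4)).
  apply: bmeasX; pose h (z : RT * @powT R n) := (z.2, z.1).
  have mh : measurable_fun setT h by apply: measurable_fun_pair.
  exact: (bmeas_comp mh bmeas_cent_joint).
apply: (@le_trans _ _ (E (fun s => (n%:R ^+ 2)^-1 * Ex U (fun t => cent s t ^+ 4)))).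
  apply: Ex_le; [exact/bmeasX/bmeas_noise|exact/bmeasZ/bswap|move=> s].
  rewrite /noise exprMn exprVn mulrC ler_wpM2l ?invr_ge0 ?exprn_ge0//.
  rewrite (le_trans (Ex_sqr_le _ _))//.
  by rewrite (@eq_Ex _ _ _ U _ (fun t => cent s t ^+ 4))// => t; rewrite -exprM.
rewrite /E ExZ; last exact: bswap.
by rewrite mulrC ler_pdivrMr ?exprn_gt0.
Qed.

Let statE (s : powT n) : sq_stat p s = Ex U (fun t => n%:R^-1 * dev p s t ^+ 2).
Proof.
by rewrite /sq_stat mulrC ExZ//; apply/bmeasX/bmeas_dev; case: pp.
Qed.

Let noiseE (s : powT n) : noise s = Ex U (fun t => n%:R^-1 * cent s t ^+ 2).
Proof. by rewrite /noise mulrC ExZ. Qed.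

Let driftE : drift = Ex U (fun t => n%:R * (p t - F0 t) ^+ 2).
Proof. by rewrite /drift ExZ//; exact: bmeasX. Qed.

Let bs (s : powT n) : @bmeas R _ RT (fun t => n%:R^-1 * dev p s t ^+ 2).
Proof. by apply/bmeasZ/bmeasX/bmeas_dev; case: pp. Qed.

Lemma sq_stat_ge (s : powT n) : drift / 2 - noise s <= sq_stat p s.
Proof.
rewrite statE noiseE driftE mulrC -ExZ; last exact/bmeasZ/bmeasX.
rewrite -ExB; [|exact/bmeasZ/bmeasZ/bmeasX|exact: bmeasZ].
apply: Ex_le => //.
  by apply: bmeasB; [exact/bmeasZ/bmeasZ/bmeasX|exact: bmeasZ].
move=> t; rewrite devE; set a := cent s t; set b := p t - F0 t.
(* Half of this square is (a + n b)^2 + a^2 - n^2 b^2 / 2. *)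
have : 0 <= n%:R^-1 * (2 * a + n%:R * b) ^+ 2 by rewrite mulr_ge0 ?invr_ge0// sqr_ge0.
have -> : n%:R^-1 * (2 * a + n%:R * b) ^+ 2 =
  4 * (n%:R^-1 * a ^+ 2) + 4 * (a * b) + n%:R * b ^+ 2 by field.
have -> : n%:R^-1 * (a + n%:R * b) ^+ 2 =
  n%:R^-1 * a ^+ 2 + 2 * (a * b) + n%:R * b ^+ 2 by field.
by lra.
Qed.

Lemma sq_stat_le (s : powT n) : sq_stat p s <= 2 * noise s + 2 * drift.
Proof.
rewrite statE noiseE driftE -!ExZ; do ?exact/bmeasZ/bmeasX; last exact/bmeasZ/bX.
rewrite -ExD; [|exact/bmeasZ/bmeasZ/bX|exact/bmeasZ/bmeasZ/bmeasX].
apply: Ex_le => //.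
  by apply: bmeasD; [exact/bmeasZ/bmeasZ/bX|exact/bmeasZ/bmeasZ/bmeasX].
move=> t; rewrite devE; set a := cent s t; set b := p t - F0 t.
have : 0 <= n%:R^-1 * (a - n%:R * b) ^+ 2 by rewrite mulr_ge0 ?invr_ge0// sqr_ge0.
have -> : n%:R^-1 * (a - n%:R * b) ^+ 2 =
  n%:R^-1 * a ^+ 2 - 2 * (a * b) + n%:R * b ^+ 2 by field.
have -> : n%:R^-1 * (a + n%:R * b) ^+ 2 =
  n%:R^-1 * a ^+ 2 + 2 * (a * b) + n%:R * b ^+ 2 by field.
by lra.
Qed.

(** The cross term vanishes because [cent] is centered. Unlike the pathwise bounds, the mean sees
    the drift without loss, which is what detects a small drift. *)
Lemma Ex_sq_stat : E (fun s : powT n => sq_stat p s) = Ex U (fun t => p t * (1 - p t)) + drift.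
Proof.
have mp : mcdf p by case: pp.
transitivity (Ex U (fun t => E (fun s => n%:R^-1 * dev p s t ^+ 2))).
  rewrite -(@Ex_swap _ _ _ (powT n) RT (powP U n) U (fun z => n%:R^-1 * dev p z.1 z.2 ^+ 2)).
    by apply: eq_Ex => s; exact: statE.
  exact/bmeasZ/bmeasX/bmeas_dev_joint.
rewrite driftE -ExD//; last exact/bmeasZ/bmeasX.
apply: eq_Ex => t; rewrite /E.
have bc : bmeas (fun s => cent s t) := bmeas_psum n (cf t).
rewrite (@eq_Ex _ _ _ _ _ (fun s => n%:R^-1 * cent s t ^+ 2 +
    ((2 * (p t - F0 t)) * cent s t + n%:R * (p t - F0 t) ^+ 2))); last first.
  by move=> s; rewrite devE; field.
rewrite ExD; [|exact/bmeasZ/bmeasX|by apply: bmeasD; [exact: bmeasZ|exact: bmeas_cst]].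
rewrite ExD; [|exact: bmeasZ|exact: bmeas_cst].
rewrite (ExZ _ n%:R^-1); last exact: bmeasX.
have := Ex_cent2 t; have := Ex_cent t; rewrite /E => e1 e2.
by rewrite (ExZ _ (2 * (p t - F0 t)))// e1 e2 Ex_cst mulr0 add0r mulKf.
Qed.

Lemma Ex_sq_stat2_le : E (fun s : powT n => sq_stat p s ^+ 2) <= 24 + 8 * drift ^+ 2.
Proof.
have bn := bmeas_noise; have mp : mcdf p by case: pp.
apply: (@le_trans _ _ (E (fun s => 8 * noise s ^+ 2 + 8 * drift ^+ 2))).
  apply: Ex_le; first exact/bmeasX/bmeas_sq_stat.
    by apply: bmeasD; [exact/bmeasZ/bmeasX|exact: bmeas_cst].
  move=> s; have s0 := sq_stat_ge0 p s; have sl := sq_stat_le s.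
  have h : sq_stat p s ^+ 2 <= (2 * noise s + 2 * drift) ^+ 2.
    by rewrite lerXn2r ?nnegrE// (le_trans s0).
  apply: (le_trans h); have : 0 <= (noise s - drift) ^+ 2 by exact: sqr_ge0.
  by rewrite !expr2; lra.
rewrite /E ExD; [|exact/bmeasZ/bmeasX|exact: bmeas_cst].
rewrite ExZ ?Ex_cst; last exact: bmeasX.
by have := Ex_noise2_le; rewrite /E; lra.
Qed.

(** By [sq_stat_ge], accepting forces the noise to reach [drift / 2 - c]; Markov's inequality bounds
    that event. *)
Lemma Ex_sq_stat_lower c : c < drift / 2 ->
  1 - E (fun s : powT n => (c < sq_stat p s)%R%:R) <= 4^-1 / (drift / 2 - c).
Proof.
move=> cd; have mp : mcdf p by case: pp.
have bi : bmeas (fun s : powT n => (c < sq_stat p s)%R%:R : R).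
  by apply: bmeas_lt; [exact: measurable_cst|case: (bmeas_sq_stat n mp)].
have d0 : 0 < drift / 2 - c by rewrite subr_gt0.
have bn := bmeas_noise.
apply: (@le_trans _ _ (E noise / (drift / 2 - c))); last first.
  by rewrite ler_pM2r ?invr_gt0// Ex_noise_le.
have -> : 1 - E (fun s : powT n => (c < sq_stat p s)%R%:R) =
    E (fun s : powT n => 1 - (c < sq_stat p s)%R%:R).
  by rewrite /E ExB ?Ex_cst//; exact: bmeas_cst.
rewrite /E mulrC -ExZ//; apply: Ex_le; [|exact: bmeasZ|move=> s].
  by apply: bmeasB => //; exact: bmeas_cst.
have := sq_stat_ge s; have := noise_ge0 s.
case: ltP => [_ N0 _|sc N0 h]; first by rewrite subrr mulr_ge0 ?invr_ge0// ltW.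
by rewrite subr0 mulrC ler_pdivlMr// mul1r; lra.
Qed.

End One.

End Moments.

(** * Anti-concentration of the statistic *)

Section QuadraticCount.
Context {R : realType}.

(* The second divided difference of a quadratic is its leading coefficient, so three
   integer points in a window of half-width [k] force that coefficient to be at most [2 k]. *)
Lemma quadratic_three_points (a b e c k : R) (i j l : nat) : 0 <= k ->
  (i < j < l)%N ->
  `|a * i%:R ^+ 2 + b * i%:R + e - c| <= k ->
  `|a * j%:R ^+ 2 + b * j%:R + e - c| <= k ->
  `|a * l%:R ^+ 2 + b * l%:R + e - c| <= k -> a <= 2 * k.
Proof.
move=> k0 /andP[ij jl].
have x1 : 1 <= j%:R - i%:R :> R by rewrite -natrB 1?ltnW// ler1n subn_gt0.
have y1 : 1 <= l%:R - j%:R :> R by rewrite -natrB 1?ltnW// ler1n subn_gt0.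
rewrite !ler_norml => /andP[i1 i2] /andP[j1 j2] /andP[l1 l2].
move: (i%:R) (j%:R) (l%:R) x1 y1 i1 i2 j1 j2 l1 l2 => xi xj xl.
set fi := a * xi ^+ 2 + _ + e - c; set fj := a * xj ^+ 2 + _ + e - c.
set fl := a * xl ^+ 2 + _ + e - c => x1 y1 i1 i2 j1 j2 l1 l2.
have x0 : 0 <= xj - xi by lra.
have y0 : 0 <= xl - xj by lra.
have id : a * (xl - xj) * (xj - xi) * (xl - xi) =
    (xj - xi) * fl - (xl - xi) * fj + (xl - xj) * fi by rewrite /fi /fj /fl; ring.
have h1 : (xj - xi) * fl <= (xj - xi) * k by rewrite ler_wpM2l.
have h2 : (xl - xj) * fi <= (xl - xj) * k by rewrite ler_wpM2l.
have h3 : (xl - xi) * (- fj) <= (xl - xi) * k by rewrite ler_wpM2l//; lra.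
have h4 : a * (xl - xj) * (xj - xi) * (xl - xi) <= 2 * k * (xl - xi) by rewrite id; lra.
have h5 : a * (xl - xj) * (xj - xi) <= 2 * k by rewrite -(@ler_pM2r _ (xl - xi))//; lra.
have [a0|a0] := leP a 0; first lra.
have m1 : 1 <= (xl - xj) * (xj - xi) by rewrite (le_trans y1)// ler_peMr.
by apply: le_trans h5; rewrite -mulrA ler_peMr// ltW.
Qed.

Lemma quadratic_count (a b e c k : R) J : 0 <= k -> 2 * k < a ->
  \sum_(0 <= j < J) (`|a * j%:R ^+ 2 + b * j%:R + e - c| <= k)%R%:R <= 2 :> R.
Proof.
move=> k0 ka; rewrite -natr_sum ler_nat.
pose h (j : nat) := (`|a * j%:R ^+ 2 + b * j%:R + e - c| <= k)%R.
have -> : (\sum_(0 <= j < J) h j = size (seq.filter h (iota 0 J)))%N.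
  by rewrite size_filter -sum1_count [RHS]big_mkcond /index_iota subn0.
have srt : sorted ltn (seq.filter h (iota 0 J)).
  by apply: sorted_filter; [exact: ltn_trans|exact: iota_ltn_sorted].
have := @mem_filter _ h ^~ (iota 0 J).
case: (seq.filter h (iota 0 J)) srt => [|i [|j [|l r]]] //= /and3P[ij jl _] mem.
have hh x : x \in [:: i, j, l & r] -> h x by rewrite mem => /andP[].
have := @quadratic_three_points a b e c k i j l k0; rewrite ij jl => /(_ isT).
have hi : h i by apply: hh; rewrite mem_head.
have hj : h j by apply: hh; rewrite !inE eqxx orbT.
have hl : h l by apply: hh; rewrite !inE eqxx !orbT.
by move=> /(_ hi hj hl); lra.
Qed.

End QuadraticCount.

(** * Stability of a test under a small perturbation of its statistic *)

Section Closeness.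
Context {R : realType}.

(** Solves (1 + 1/eta) x = k / 2 for eta = k / (2 (C + k)), the choice made in
    [dominates_upto_le]. *)
Definition tolerance (C k : R) := k ^+ 2 / (2 * (2 * C + 3 * k)).

Lemma tolerance_gt0 C k : 0 <= C -> 0 < k -> 0 < tolerance C k.
Proof. by move=> C0 k0; rewrite /tolerance divr_gt0 ?exprn_gt0//; lra. Qed.

(** The triangle inequality sqrt A <= sqrt B + sqrt dl without square roots: for nonnegative [B] and
    [dl], the infimum over [eta] of the right-hand side is (sqrt B + sqrt dl)^2. *)
Definition dominates_upto (A B dl : R) :=
  forall eta : R, 0 < eta -> A <= (1 + eta) * B + (1 + eta^-1) * dl.

Lemma dominates_upto_le A B dl C k : 0 <= C -> 0 < k -> dl <= tolerance C k ->
  B <= C + k -> dominates_upto A B dl -> A <= B + k.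
Proof.
move=> C0 k0 dk BC; pose eta := k / (2 * (C + k)).
have e0 : 0 < eta by rewrite divr_gt0//; lra.
move=> /(_ _ e0) h; apply: (le_trans h).
have h1 : eta * B <= k / 2.
  have -> : k / 2 = eta * (C + k) by rewrite /eta; field; lra.
  by rewrite ler_wpM2l// ltW.
have h2 : (1 + eta^-1) * dl <= k / 2.
  have -> : k / 2 = (1 + eta^-1) * tolerance C k.
    by rewrite /eta /tolerance; field; repeat split; lra.
  by rewrite ler_wpM2l// addr_ge0// invr_ge0 ltW.
by lra.
Qed.

Section Window.
Variables (A B dl C k c : R).
Hypotheses (C0 : 0 <= C) (k0 : 0 < k) (dk : dl <= tolerance C k) (cC : c <= C).
Hypotheses (AB : dominates_upto A B dl) (BA : dominates_upto B A dl).

Lemma window_transfer : `|A - c| <= k -> `|B - c| <= 2 * k.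
Proof.
have cC' := cC; have k0' := k0.
rewrite !ler_norml => /andP[h1 h2].
have AC : A <= C + k by lra.
have BAk := dominates_upto_le C0 k0 dk AC BA.
(* The comparison is absolute only below [C + k]; a larger [B] exceeds [c] anyway, so the lower
   bound needs no comparison there. *)
have [BC|BC] := leP B (C + k); last by apply/andP; split; lra.
have ABk := dominates_upto_le C0 k0 dk BC AB.
by apply/andP; split; lra.
Qed.

Lemma test_transfer : k < `|A - c| -> (c < A) = (c < B).
Proof.
have cC' := cC; have k0' := k0.
case: ger0P => Ac h.
- have [BC|BC] := leP B (C + k); last by apply/idP/idP => ?; lra.
  have ABk := dominates_upto_le C0 k0 dk BC AB.
  by apply/idP/idP => ?; lra.
- have AC : A <= C + k by lra.
  have BAk := dominates_upto_le C0 k0 dk AC BA.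
  by apply/idP/idP => ?; lra.
Qed.

End Window.

End Closeness.

(** * Two distribution functions on one uniform sample *)

Section Comparison.
Context {R : realType}.
Let RT := measurableTypeR R.
Let U := @Unif R.
Variable n : nat.
Hypothesis n0 : (0 < n)%N.
Let nr0 : 0 < n%:R :> R. Proof. by rewrite ltr0n. Qed.
Let nrn0 : n%:R != 0 :> R. Proof. by rewrite gt_eqF. Qed.
Implicit Types (p q : R -> R).

Lemma dominates_upto_sq (f g : RT -> R) : @bmeas R _ RT f -> @bmeas R _ RT g ->
  dominates_upto (Ex U (fun t => f t ^+ 2) / n%:R) (Ex U (fun t => g t ^+ 2) / n%:R)
    (Ex U (fun t => (f t - g t) ^+ 2) / n%:R).
Proof.
move=> bf bg eta e0; rewrite !mulrA -mulrDl ler_pM2r ?invr_gt0//.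
have bfg := bmeasX 2 (bmeasB bf bg).
rewrite -!ExZ//; [|exact: bmeasX]; rewrite -ExD; [|exact/bmeasZ/bmeasX|exact: bmeasZ].
apply: Ex_le; [exact: bmeasX| |move=> t].
  by apply: bmeasD; [exact/bmeasZ/bmeasX|exact: bmeasZ].
rewrite -subr_ge0.
have -> : (1 + eta) * g t ^+ 2 + (1 + eta^-1) * (f t - g t) ^+ 2 - f t ^+ 2 =
  eta^-1 * (eta * g t - (f t - g t)) ^+ 2 by field; rewrite gt_eqF.
by rewrite mulr_ge0 ?invr_ge0 ?sqr_ge0// ltW.
Qed.

Section TwoCdfs.
Variables p q : R -> R.
Hypotheses (pp : pcdf p) (pq : pcdf q).

Let inc t u : R := (u <= p t)%R%:R - (u <= q t)%R%:R - (p t - q t).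

Let binc t : @bmeas R _ RT (inc t).
Proof.
apply: bmeasB; last exact: bmeas_cst.
by apply: bmeasB; exact: bmeas_ray.
Qed.

Let Er (r : R -> R) t : pcdf r -> Ex U (fun u : RT => (u <= r t)%R%:R) = r t.
Proof. by move=> [_ r01]; rewrite Ex_Unif_ray F0_id. Qed.

Let Einc t : Ex U (inc t) = 0.
Proof.
rewrite /inc ExB; [|by apply: bmeasB; exact: bmeas_ray|exact: bmeas_cst].
have -> : Ex U (fun u : RT => (u <= p t)%R%:R - (u <= q t)%R%:R) = p t - q t.
  by rewrite ExB; [rewrite (Er t pp) (Er t pq)|exact: bmeas_ray|exact: bmeas_ray].
by rewrite Ex_cst subrr.
Qed.

Let Einc2 t : Ex U (fun u => inc t u ^+ 2) <= `|p t - q t|.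
Proof.
have /andP[p1 p2] := pp.2 t; have /andP[q1 q2] := pq.2 t.
pose a := p t - q t.
(* Two rays differ by an interval, so the square is the indicator of an event of probability |p t -
   q t|. *)
have E1 : Ex U (fun u : RT => ((u <= p t)%R%:R - (u <= q t)%R%:R) ^+ 2) = `|a|.
  rewrite (@eq_Ex _ _ _ U _ (fun u : RT => `|(u <= p t)%R%:R - (u <= q t)%R%:R|)); last first.
    by move=> u; case: (u <= p t); case: (u <= q t); rewrite /= ?subrr ?subr0 ?sub0r ?normrN
      ?normr0 ?normr1 ?sqrrN ?expr0n ?expr1n.
  have [pq'|pq'] := leP (q t) (p t).
    rewrite (@eq_Ex _ _ _ U _ (fun u : RT => (u <= p t)%R%:R - (u <= q t)%R%:R)); last first.
      move=> u; rewrite ger0_norm// subr_ge0 ler_nat.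
      by case: (leP u (q t)) => // h; rewrite (le_trans h).
    rewrite ExB; [|exact: bmeas_ray|exact: bmeas_ray].
    by rewrite (Er t pp) (Er t pq) ger0_norm// subr_ge0.
  rewrite (@eq_Ex _ _ _ U _ (fun u : RT => (u <= q t)%R%:R - (u <= p t)%R%:R)); last first.
    move=> u; rewrite distrC ger0_norm// subr_ge0 ler_nat.
    by case: (leP u (p t)) => // h; rewrite (le_trans h (ltW pq')).
  rewrite ExB; [|exact: bmeas_ray|exact: bmeas_ray].
  by rewrite (Er t pp) (Er t pq) ltr0_norm ?opprB// subr_lt0.
pose w (u : RT) : R := (u <= p t)%R%:R - (u <= q t)%R%:R.
have bw : @bmeas R _ RT w by apply: bmeasB; exact: bmeas_ray.
have Ew : Ex U w = a by rewrite /w ExB; [rewrite (Er t pp) (Er t pq)|exact: bmeas_ray|exact: bmeas_ray].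
rewrite (@eq_Ex _ _ _ U _ (fun u => w u ^+ 2 + ((- 2 * a) * w u + a ^+ 2))); last first.
  by move=> u; rewrite /inc /w /a; ring.
rewrite ExD; [|exact: bmeasX|by apply: bmeasD; [exact: bmeasZ|exact: bmeas_cst]].
rewrite ExD; [|exact: bmeasZ|exact: bmeas_cst].
rewrite [Ex U (fun x => w x ^+ 2)]E1 ExZ// Ew Ex_cst.
by have := sqr_ge0 a; rewrite -/a; nra.
Qed.

Lemma dev_sub (s : powT n) t : dev p s t - dev q s t - n%:R * (p t - q t) = psum (inc t) s.
Proof. by rewrite /dev -(psum_cst _ s) -!psumB; apply: eq_psum => u; rewrite /inc; ring. Qed.

Let cg (s : powT n) t := dev p s t - dev q s t - n%:R * (p t - q t).

Lemma bmeas_dev_sub_joint : bmeas (fun z : powT n * RT => dev p z.1 z.2 - dev q z.1 z.2).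
Proof. by apply: bmeasB; apply: bmeas_dev_joint; [case: pp|case: pq]. Qed.

Let bcg : bmeas (fun z : powT n * RT => cg z.1 z.2).
Proof.
apply: bmeasB; first exact: bmeas_dev_sub_joint.
by apply: bmeasZ; apply: bmeasB; apply/bmeas_snd/pcdf_bmeas.
Qed.

(** At each [t] this is the variance of a sum of [n] independent increments, each of variance at
    most |p t - q t|. Keeping the mean shift apart matters for tilts, where that shift is the signal
    rather than an error. *)
Lemma Ex_gap_centered :
  Ex (powP U n) (fun s => Ex U (fun t => cg s t ^+ 2) / n%:R) <= Ex U (fun t => `|p t - q t|).
Proof.
have bcg2 := bmeasX 2 bcg.
under eq_Ex do rewrite mulrC.
rewrite ExZ; last exact: (bmeas_Ex _ bcg2).
rewrite (@Ex_swap _ _ _ (powT n) RT (powP U n) U (fun z => cg z.1 z.2 ^+ 2))//.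
have bn : @bmeas R _ RT (fun t => `|p t - q t|).
  by apply: bmeas_norm; apply: bmeasB; exact: pcdf_bmeas.
rewrite mulrC ler_pdivrMr// mulrC -ExZ//; apply: Ex_le; [|exact: bmeasZ|move=> t].
  pose h (z : RT * @powT R n) := (z.2, z.1).
  have mh : measurable_fun setT h by apply: measurable_fun_pair.
  exact: (bmeas_Ex _ (bmeas_comp mh bcg2)).
rewrite /cg; under eq_Ex do rewrite /= dev_sub.
by rewrite Ex_psum2// ler_wpM2l.
Qed.

Lemma Ex_gap :
  Ex (powP U n) (fun s => Ex U (fun t => (dev p s t - dev q s t) ^+ 2) / n%:R) <=
  2 * Ex U (fun t => `|p t - q t|) + 2 * (n%:R * dist2 p q).
Proof.
have bcg2 := bmeasX 2 bcg; have bd2 := bmeasX 2 bmeas_dev_sub_joint.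
have bpq : @bmeas R _ RT (fun t => p t - q t) by apply: bmeasB; exact: pcdf_bmeas.
apply: (@le_trans _ _ (Ex (powP U n) (fun s =>
    2 * (Ex U (fun t => cg s t ^+ 2) / n%:R) + 2 * (n%:R * dist2 p q)))).
  have bm (F : @powT R n * RT -> R) : bmeas F ->
      bmeas (fun s => Ex U (fun t => F (s, t)) / n%:R).
    by move=> bF; under eq_fun do rewrite mulrC; exact/bmeasZ/(bmeas_Ex _ bF).
  apply: Ex_le; [exact: (bm (fun z => (dev p z.1 z.2 - dev q z.1 z.2) ^+ 2) bd2)| |move=> s].
    by apply: bmeasD; [exact/bmeasZ/(bm (fun z => cg z.1 z.2 ^+ 2) bcg2)|exact: bmeas_cst].
  have b1 : @bmeas R _ RT (fun t => cg s t ^+ 2) := bmeas_section1 s bcg2.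
  have b2 : @bmeas R _ RT (fun t => (dev p s t - dev q s t) ^+ 2) := bmeas_section1 s bd2.
  rewrite ler_pdivrMr//; set A := Ex U (fun t => cg s t ^+ 2).
  have -> : (2 * (A / n%:R) + 2 * (n%:R * dist2 p q)) * n%:R =
    2 * A + (2 * n%:R ^+ 2) * dist2 p q by field.
  rewrite /A /dist2 -!ExZ//; last exact: bmeasX.
  rewrite -ExD; [|exact: bmeasZ|exact/bmeasZ/bmeasX].
  apply: Ex_le => // [|t].
    by apply: bmeasD; [exact: bmeasZ|exact/bmeasZ/bmeasX].
  rewrite /cg; set x := dev p s t - dev q s t; set y := p t - q t.
  by have := sqr_ge0 (x - 2 * (n%:R * y)); rewrite !expr2; nra.
rewrite ExD; [| |exact: bmeas_cst]; last first.
  by apply: bmeasZ; under eq_fun do rewrite mulrC; exact/bmeasZ/(bmeas_Ex _ bcg2).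
rewrite Ex_cst lerD2r ExZ; last first.
  by under eq_fun do rewrite mulrC; exact/bmeasZ/(bmeas_Ex _ bcg2).
by rewrite ler_pM2l// Ex_gap_centered.
Qed.

End TwoCdfs.

End Comparison.

(** * Change of measure by tilting *)

Section Tilting.
Context {R : realType}.
Let RT := measurableTypeR R.
Let U := @Unif R.
Variables (n : nat) (p : R -> R).
Hypothesis pp : pcdf p.
Let E := Ex (powP U n).

Definition tilted (th : R) (t : R) : R := tilt_cdf th (p t).

Lemma pcdf_tilted th : 0 <= th < 1 -> pcdf (tilted th).
Proof.
have [mp p01] := pp; move=> /andP[t0 t1]; split.
  have mc : measurable_fun [set: RT] (tilt_cdf th : RT -> RT).
    apply: measurable_funD; first exact: measurable_id.
    apply: measurable_funM; first exact: measurable_cst.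
    apply: measurable_minr; first exact: measurable_id.
    by apply: measurable_funB; [exact: measurable_cst|exact: measurable_id].
  exact: (measurableT_comp mc mp).
move=> t; have /andP[? ?] := p01 t; rewrite /tilted /tilt_cdf.
by case: (leP (p t) (1 - p t)) => ?; nra.
Qed.

Lemma sq_stat_tilt th (s : powT n) : 0 <= th < 1 ->
  sq_stat p (pmap (tilt_map th) s) = sq_stat (tilted th) s.
Proof.
move=> tP; congr (_ / _); apply: eq_Ex => t; congr (_ ^+ 2).
by rewrite /dev psum_pmap; apply: eq_psum => u; rewrite tilt_map_le.
Qed.

(** Reweighting the sample has the same effect as replacing [p] by its tilt, so the laws of the two
    statistics are as close as the weight is to 1 in mean. *)
Lemma Ex_tilt_stat th (g : R -> R) : 0 <= th < 1 ->
  bmeas (fun s : powT n => g (sq_stat p s)) ->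
  E (fun s => pprod (tilt th) s * g (sq_stat p s)) =
  E (fun s => g (sq_stat (tilted th) s)).
Proof.
move=> tP bg; transitivity (E (fun s => g (sq_stat p (pmap (tilt_map th) s)))).
  apply: Ex_pow_map => //; [exact: bmeas_tilt|exact: measurable_tilt_map|].
  by move=> f bf; exact: Ex_tilt.
by apply: eq_Ex => s; rewrite sq_stat_tilt.
Qed.

Let half : F0 (2^-1 : R) = 2^-1.
Proof. by rewrite F0_id//; apply/andP; split; lra. Qed.

Lemma Ex_tilt_weight th : Ex U (tilt th) = 1.
Proof.
rewrite ExD; [|exact: bmeas_cst|exact/bmeasZ/bmeas_ray].
by rewrite Ex_cst ExZ ?Ex_Unif_ray ?half; [field|exact: bmeas_ray].
Qed.

Lemma Ex_tilt_weight2 th : Ex U (fun u => tilt th u ^+ 2) = 1 + th ^+ 2.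
Proof.
rewrite (@eq_Ex _ _ _ U _ (fun u : RT => (1 - th) ^+ 2 + (4 * th) * (u <= 2^-1)%R%:R)).
  rewrite ExD; [|exact: bmeas_cst|exact/bmeasZ/bmeas_ray].
  by rewrite Ex_cst ExZ ?Ex_Unif_ray ?half; [field|exact: bmeas_ray].
by move=> u; rewrite /tilt; case: (u <= _) => /=; ring.
Qed.

Let bw th : bmeas (@pprod R n (tilt th)).
Proof. exact/bmeas_pprod/bmeas_tilt. Qed.
Let bw1 th : bmeas (fun s : powT n => pprod (tilt th) s - 1 : R).
Proof. by apply: bmeasB => //; exact: bmeas_cst. Qed.

(** The weight has mean 1, so its variance is (1 + th^2)^n - 1, and the L^2 norm dominates the L^1
    norm. *)
Lemma tilt_L1 th e : 0 <= e -> n%:R * th ^+ 2 <= 2^-1 -> 2 * (n%:R * th ^+ 2) <= e ^+ 2 ->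
  E (fun s => `|pprod (tilt th) s - 1|) <= e.
Proof.
move=> e0 small le_e.
(* A reverse Bernoulli inequality: while [m a] is at most 1/2, the second-order term of each step is
   absorbed by doubling the slope. *)
have pw (a : R) m : 0 <= a -> m%:R * a <= 2^-1 -> (1 + a) ^+ m <= 1 + 2 * (m%:R * a).
  move=> a0; elim: m => [|m IH]; first by rewrite expr0 mul0r mulr0 addr0.
  rewrite -natr1 exprSr mulrDl mul1r => h.
  have {}IH := IH (le_trans (ler_wpDr a0 (lexx _)) h).
  apply: (le_trans (ler_wpM2r _ IH)); first lra.
  have : (m%:R * a) * a <= 2^-1 * a by rewrite ler_wpM2r//; lra.
  by set y := m%:R * a; nra.
have E2 : E (fun s => (pprod (tilt th) s - 1) ^+ 2) <= e ^+ 2.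
  rewrite /E (@eq_Ex _ _ _ _ _ (fun s => pprod (fun u => tilt th u ^+ 2) s +
     ((- 2) * pprod (tilt th) s + 1))); last by move=> s; rewrite -pprodX2; ring.
  rewrite ExD; [| |by apply: bmeasD; [exact: bmeasZ|exact: bmeas_cst]]; last first.
    exact/bmeas_pprod/bmeasX/bmeas_tilt.
  rewrite ExD; [|exact: bmeasZ|exact: bmeas_cst].
  rewrite (ExZ _ (-2))// Ex_cst (Ex_pprod U n (bmeas_tilt th)).
  rewrite (Ex_pprod U n (bmeasX 2 (bmeas_tilt th))).
  rewrite Ex_tilt_weight Ex_tilt_weight2 expr1n.
  by have := pw (th ^+ 2) n (sqr_ge0 _) small; lra.
rewrite -(@ler_pXn2r _ 2)// ?nnegrE//; last by apply: Ex_ge0 => s.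
apply: le_trans E2; apply: le_trans (Ex_sqr_le _ (bmeas_norm (bw1 th))) _.
rewrite (@eq_Ex _ _ _ _ _ (fun s => (pprod (tilt th) s - 1) ^+ 2))// => s.
by rewrite -normrX ger0_norm// sqr_ge0.
Qed.

Lemma tilt_le th e (g : R -> R) : 0 <= th < 1 -> 0 <= e ->
  n%:R * th ^+ 2 <= 2^-1 -> 2 * (n%:R * th ^+ 2) <= e ^+ 2 ->
  (forall x, 0 <= g x <= 1) -> bmeas (fun s : powT n => g (sq_stat p s)) ->
  E (fun s => g (sq_stat p s)) <= E (fun s => g (sq_stat (tilted th) s)) + e.
Proof.
move=> tP e0 h1 h2 g01 bg; rewrite -Ex_tilt_stat// -lerBlDl.
rewrite -ExB//; last exact: bmeasM.
apply: le_trans (tilt_L1 e0 h1 h2); apply: Ex_le.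
- by apply: bmeasB => //; exact: bmeasM.
- exact: bmeas_norm.
move=> s; have /andP[g0 g1] := g01 (sq_stat p s); set x := pprod _ s; set y := g _ in g0 g1 *.
have -> : y - x * y = y * (1 - x) by ring.
rewrite (le_trans (ler_norm _))// normrM distrC ger0_norm//.
by rewrite ler_piMl.
Qed.

End Tilting.

(** * Probability of a narrow window *)

Section AntiConcentration.
Context {R : realType}.
Let RT := measurableTypeR R.
Let U := @Unif R.

Definition mid (p : R -> R) (t : R) : R := Num.min (p t) (1 - p t).

Lemma mid_01 p t : pcdf p -> 0 <= mid p t <= 1.
Proof.
by move=> [_ /(_ t)/andP[? ?]]; rewrite /mid; case: (leP (p t)) => ?; apply/andP; split; lra.
Qed.

Lemma bmeas_mid p : pcdf p -> @bmeas R _ RT (mid p).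
Proof.
move=> pp; split; last first.
  by exists 1 => t; have /andP[? ?] := mid_01 t pp; rewrite ger0_norm.
have [mp _] := pp; apply: measurable_minr => //.
by apply: measurable_funB => //; exact: measurable_cst.
Qed.

(** On the middle half of [0, 1] both t and 1 - t are at least 1/4, so the integral of min(t, 1 -
    t)^2 is at least 1/32. Passing from t to p costs a factor 2 and twice [dist2], leaving 1/64 -
    1/128. *)
Lemma Ex_mid2_ge p : pcdf p -> dist2 p (@F0 R) <= 128^-1 ->
  128^-1 <= Ex U (fun t => mid p t ^+ 2).
Proof.
move=> pp dp; have bm := bmeas_mid pp; have bp := pcdf_bmeas pp.
have bd : @bmeas R _ RT (fun t => (p t - F0 t) ^+ 2).
  by apply/bmeasX/bmeasB => //; exact: bmeas_F0.
have E1 : Ex U (fun t : RT => 16^-1 * ((t <= 3 / 4)%R%:R - (t <= 4^-1)%R%:R)) = 32^-1.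
  rewrite ExZ; last by apply: bmeasB; exact: bmeas_ray.
  rewrite ExB; [|exact: bmeas_ray|exact: bmeas_ray].
  by rewrite !Ex_Unif_ray !F0_id; [field|apply/andP; split; lra|apply/andP; split; lra].
have : 32^-1 <= 2 * Ex U (fun t => mid p t ^+ 2) + 2 * dist2 p (@F0 R); last by lra.
rewrite -E1 /dist2 -!ExZ//; last exact: bmeasX.
rewrite -ExD; [|exact/bmeasZ/bmeasX|exact: bmeasZ].
apply: Ex_le.
- by apply: bmeasZ; apply: bmeasB; exact: bmeas_ray.
- by apply: bmeasD; [exact/bmeasZ/bmeasX|exact: bmeasZ].
move=> t; have [t1|t1] := leP t 4^-1.
  rewrite (_ : (t <= 3 / 4)%R); last by lra.
  by rewrite subrr mulr0 addr_ge0// mulr_ge0// sqr_ge0.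
have [t2|t2] := leP t (3 / 4); last first.
  by rewrite subrr mulr0 addr_ge0// mulr_ge0// sqr_ge0.
rewrite F0_id; last by apply/andP; split; lra.
rewrite subr0 mulr1 /mid; case: (leP (p t) (1 - p t)) => _.
- have := sqr_ge0 (2 * p t - t); have : 4^-1 ^+ 2 <= t ^+ 2 by rewrite lerXn2r ?nnegrE//; lra.
  by rewrite !expr2; lra.
- have := sqr_ge0 (2 * (1 - p t) - (1 - t)).
  have : 4^-1 ^+ 2 <= (1 - t) ^+ 2 by rewrite lerXn2r ?nnegrE//; lra.
  by rewrite !expr2; lra.
Qed.

Variables (n : nat) (p : R -> R).
Hypotheses (n0 : (0 < n)%N) (pp : pcdf p).
Let E := Ex (powP U n).
Let nr0 : 0 < n%:R :> R. Proof. by rewrite ltr0n. Qed.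
Let nrn0 : n%:R != 0 :> R. Proof. by rewrite gt_eqF. Qed.

Lemma bmeas_window (q : R -> R) (c k : R) : pcdf q ->
  bmeas (fun s : powT n => (`|sq_stat q s - c| <= k)%R%:R : R).
Proof.
move=> [mq _]; apply: bmeas_le; last exact: measurable_cst.
have [mS _] := bmeas_sq_stat n mq.
by apply: measurableT_comp => //; apply: measurable_funB => //; exact: measurable_cst.
Qed.

(* The statistic [sq_stat (tilted p th)] up to a sampling error: a quadratic in [th]. *)
Let shifted th (s : powT n) t := dev p s t + n%:R * (th * mid p t).
Let quad th (s : powT n) := Ex U (fun t => shifted th s t ^+ 2) / n%:R.

Let bdev (s : powT n) : @bmeas R _ RT (dev p s).
Proof. by apply: bmeas_dev; case: pp. Qed.

Let quadE th s : quad th s = (n%:R * Ex U (fun t => mid p t ^+ 2)) * th ^+ 2 +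
  (2 * Ex U (fun t => dev p s t * mid p t)) * th + sq_stat p s.
Proof.
have bm := bmeas_mid pp; have bd := bdev s.
rewrite /quad /sq_stat (@eq_Ex _ _ _ U _ (fun t => (n%:R ^+ 2 * th ^+ 2) * mid p t ^+ 2 +
  ((2 * n%:R * th) * (dev p s t * mid p t) + dev p s t ^+ 2))); last first.
  by move=> t; rewrite /shifted; ring.
have b1 := bmeasM bd bm; have b2 := bmeasX 2 bm; have b3 := bmeasX 2 bd.
rewrite ExD; [|exact: bmeasZ|by apply: bmeasD => //; exact: bmeasZ].
rewrite ExD//; last exact: bmeasZ.
by rewrite (ExZ _ (n%:R ^+ 2 * th ^+ 2))// (ExZ _ (2 * n%:R * th))//; field.
Qed.

Let bshift th : bmeas (fun z : powT n * RT => shifted th z.1 z.2).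
Proof.
apply: bmeasD; first by apply: bmeas_dev_joint; case: pp.
by do 2 apply: bmeasZ; exact: bmeas_snd (bmeas_mid pp).
Qed.

Let bquad th : bmeas (quad th).
Proof.
rewrite /quad; under eq_fun do rewrite mulrC; apply: bmeasZ.
exact: (bmeas_Ex _ (bmeasX 2 (bshift th))).
Qed.

Let win c k (x : R) : R := (`|x - c| <= k)%R%:R.

Let bwinq th c k : bmeas (fun s => win c k (quad th s)).
Proof.
apply: bmeas_le; last exact: measurable_cst.
have [mS _] := bquad th.
by apply: measurableT_comp => //; apply: measurable_funB => //; exact: measurable_cst.
Qed.

(** Tilting costs [e] in total variation. Replacing the tilted statistic by the quadratic doubles
    the window and costs the probability of a large gap, whose mean is at most [th] because the tilt
    moves [p] by [th * mid p]. *)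
Let window_step th c C k e : 0 <= th < 1 -> 0 <= e ->
  n%:R * th ^+ 2 <= 2^-1 -> 2 * (n%:R * th ^+ 2) <= e ^+ 2 ->
  0 <= C -> 0 < k -> c <= C ->
  E (fun s => win c k (sq_stat p s)) <=
  E (fun s => win c (2 * k) (quad th s)) + th / tolerance C k + e.
Proof.
move=> tP e0 h1 h2 C0 k0 cC; have tol0 := tolerance_gt0 C0 k0.
have pt := pcdf_tilted pp tP.
have wb : forall x, 0 <= win c k x <= 1.
  by move=> x; rewrite /win ler0n lern1 leq_b1.
have tl := @tilt_le R n p th e (win c k) tP e0 h1 h2 wb (bmeas_window c k pp).
apply: (le_trans tl).
rewrite lerD2r.
pose gap (s : powT n) := Ex U (fun t => (dev (tilted p th) s t - shifted th s t) ^+ 2) / n%:R.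
have bgap : bmeas gap.
  rewrite /gap; under eq_fun do rewrite mulrC; apply: bmeasZ.
  apply: (@bmeas_Ex _ _ _ (powT n) RT U
    (fun z => (dev (tilted p th) z.1 z.2 - shifted th z.1 z.2) ^+ 2)).
  by apply/bmeasX/bmeasB => //; apply: bmeas_dev_joint; case: pt.
have gap0 s : 0 <= gap s.
  by rewrite mulr_ge0 ?invr_ge0//; apply: Ex_ge0 => t; exact: sqr_ge0.
have Egap : E gap <= th.
  have := Ex_gap_centered n0 pt pp.
  have -> : Ex (powP U n) (fun s => Ex U (fun t => (dev (tilted p th) s t - dev p s t -
      n%:R * (tilted p th t - p t)) ^+ 2) / n%:R) = E gap.
    apply: eq_Ex => s; congr (_ / _); apply: eq_Ex => t; congr (_ ^+ 2).
    by rewrite /shifted /tilted /tilt_cdf /mid; ring.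
  move=> h; apply: (le_trans h); apply: Ex_le_cst.
    by apply: bmeas_norm; apply: bmeasB; exact: pcdf_bmeas.
  move=> t; rewrite /tilted /tilt_cdf addrC addKr -/(mid p t).
  have /andP[m0 m1] := mid_01 t pp; move/andP: tP => [t0 _].
  by rewrite ger0_norm ?mulr_ge0// ler_piMr.
have bl : bmeas (fun s : powT n => (tolerance C k < gap s)%R%:R : R).
  by apply: bmeas_lt; [exact: measurable_cst|case: bgap].
apply: (@le_trans _ _ (E (fun s => win c (2 * k) (quad th s) + (tolerance C k < gap s)%R%:R))).
  apply: Ex_le; [exact: bmeas_window|exact: bmeasD|move=> s].
  have [_|small] := ltP (tolerance C k) (gap s).
    by rewrite (le_trans (andP (wb _)).2)// ler_wpDl// /win ler0n.
  rewrite addr0 /win ler_nat; case: (boolP (`|sq_stat _ s - c| <= k)%R) => // w.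
  have bs1 : @bmeas R _ RT (dev (tilted p th) s) by apply: bmeas_dev; case: pt.
  have bs2 : @bmeas R _ RT (shifted th s) := bmeas_section1 s (bshift th).
  have AB := dominates_upto_sq n0 bs1 bs2.
  have BA : dominates_upto (quad th s) (sq_stat (tilted p th) s) (gap s).
    have := dominates_upto_sq n0 bs2 bs1.
    rewrite (_ : Ex U (fun t => (shifted th s t - _ t) ^+ 2) / _ = gap s)//.
    by congr (_ / _); apply: eq_Ex => t; rewrite -sqrrN opprB.
  by rewrite (window_transfer C0 k0 small cC AB BA w).
rewrite /E ExD// lerD2l (le_trans (Ex_markov _ bgap gap0 tol0))//.
by rewrite ler_pM2r ?invr_gt0.
Qed.

(** Sum of [window_step] over the tilts [j h] with [j < J]. The error terms are the share of tilts
    whose quadratic meets the window, the sampling error bounded at the largest tilt, and the change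
    of measure. *)
Lemma anti_concentration (J : nat) (h c C k e : R) :
  (0 < J)%N -> 0 < h -> J%:R * h < 1 -> 0 <= e ->
  2 * (J%:R ^+ 2 * (n%:R * h ^+ 2)) <= 1 ->
  2 * (J%:R ^+ 2 * (n%:R * h ^+ 2)) <= e ^+ 2 ->
  0 <= C -> 0 < k -> c <= C ->
  4 * k < n%:R * h ^+ 2 * Ex U (fun t => mid p t ^+ 2) ->
  E (fun s => (`|sq_stat p s - c| <= k)%R%:R) <=
  2 / J%:R + J%:R * h / tolerance C k + e.
Proof.
move=> J0 h0 Jh e0 s1 s2 C0 k0 cC kq; have tol0 := tolerance_gt0 C0 k0.
have Jr : 0 < J%:R :> R by rewrite ltr0n.
set L := E _; set D := J%:R * h / tolerance C k.
suff JL : J%:R * L <= 2 + J%:R * (D + e).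
  rewrite -(@ler_pM2l _ J%:R)// (le_trans JL)// le_eqVlt; apply/orP; left; apply/eqP.
  by clearbody D; field; rewrite gt_eqF.
have step (j : nat) : (0 <= j < J)%N ->
    L <= E (fun s => win c (2 * k) (quad (j%:R * h) s)) + (D + e).
  move=> /andP[_ jJ]; have jJr : j%:R <= J%:R :> R by rewrite ler_nat ltnW.
  have jh : j%:R * h <= J%:R * h by rewrite ler_wpM2r// ltW.
  have jh0 : 0 <= j%:R * h by rewrite mulr_ge0// ltW.
  have nth : n%:R * (j%:R * h) ^+ 2 <= J%:R ^+ 2 * (n%:R * h ^+ 2).
    have jJ2 : j%:R ^+ 2 <= J%:R ^+ 2 :> R by rewrite lerXn2r ?nnegrE.
    have nh0 : 0 <= n%:R * h ^+ 2 by rewrite mulr_ge0// sqr_ge0.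
    by rewrite exprMn mulrCA; exact: ler_wpM2r.
  have tP : 0 <= j%:R * h < 1 by rewrite jh0 (le_lt_trans jh).
  have := @window_step (j%:R * h) c C k e tP e0 _ _ C0 k0 cC.
  have s1' : n%:R * (j%:R * h) ^+ 2 <= 2^-1.
    rewrite -(@ler_pM2l R 2)// mulfV ?pnatr_eq0//.
    by apply: le_trans s1; rewrite ler_pM2l.
  have s2' : 2 * (n%:R * (j%:R * h) ^+ 2) <= e ^+ 2.
    by apply: le_trans s2; rewrite ler_pM2l.
  move=> /(_ s1' s2'); rewrite -addrA => st; apply: (le_trans st).
  rewrite lerD2l lerD2r ler_wpM2r ?invr_ge0// ltW//.
have -> : J%:R * L = \sum_(0 <= j < J) L by rewrite sumr_const_nat subn0 mulr_natl.
apply: (le_trans (ler_sum_nat step)).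
rewrite big_split /= sumr_const_nat subn0 -[(D + e) *+ J]mulr_natl lerD2r.
rewrite -Ex_sum; last by move=> j; exact: bwinq.
apply: Ex_le_cst; first by apply: bmeas_sum => j; exact: bwinq.
move=> s; rewrite (eq_bigr (fun j : nat => (`|(n%:R * Ex U (fun t => mid p t ^+ 2) * h ^+ 2) * j%:R ^+ 2
  + (2 * Ex U (fun t => dev p s t * mid p t) * h) * j%:R + sq_stat p s - c| <= 2 * k)%R%:R)); last first.
  by move=> j _; rewrite /win quadE; congr ((`| _ + _ + _ - _ | <= _)%R%:R); ring.
(* The window now has half-width [2 * k], so the leading coefficient in [j] must exceed [4 * k]. *)
by apply: quadratic_count; [lra|move: kq; rewrite mulrAC; lra].
Qed.

End AntiConcentration.

(** * Comparing two alternatives *)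

Section LayerCake.
Context {R : realType}.
Implicit Types (x eta : R) (J : nat).

(** Left Riemann sums with mesh [eta] of the integral of 1[y < x] over [0, J eta]. The integrand is
    nonincreasing, so they overestimate; the companion bound says by at most [eta]. *)
Lemma layer_cake_ge x eta J : 0 <= x -> 0 < eta ->
  Num.min x (J%:R * eta) <= eta * \sum_(0 <= j < J) (j%:R * eta < x)%R%:R.
Proof.
move=> x0 e0; elim: J => [|J IH]; first by rewrite big_geq// mulr0 mul0r ge_min lexx orbT.
rewrite big_nat_recr//= mulrDr -natr1 mulrDl mul1r.
move: IH; set S := eta * _; case: (ltP (J%:R * eta) x) => h; rewrite ?mulr1 ?mulr0 /=.
- move=> IH.
  by apply: (@le_trans _ _ (J%:R * eta + eta)); [rewrite ge_min lexx orbT|lra].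
- move=> IH.
  by apply: (@le_trans _ _ x); [rewrite ge_min lexx|lra].
Qed.

Lemma layer_cake_le x eta J : 0 <= x -> 0 < eta ->
  eta * \sum_(0 <= j < J) (j%:R * eta < x)%R%:R <= Num.min (x + eta) (J%:R * eta).
Proof.
move=> x0 e0; elim: J => [|J IH].
  by rewrite big_geq// mulr0 mul0r le_min lexx andbT; lra.
rewrite big_nat_recr//= mulrDr -natr1 mulrDl mul1r.
move: IH; rewrite !le_min; set S := eta * _ => /andP[h1 h2].
by case: (ltP (J%:R * eta) x) => h; rewrite ?mulr1 ?mulr0 /=; apply/andP; split; lra.
Qed.

Lemma var_lipschitz (a b : R) : 0 <= a <= 1 -> 0 <= b <= 1 ->
  b * (1 - b) - a * (1 - a) <= `|a - b|.
Proof.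
move=> /andP[a0 a1] /andP[b0 b1].
have -> : b * (1 - b) - a * (1 - a) = (a - b) * (a + b - 1) by ring.
rewrite (le_trans (ler_norm _))// normrM ler_piMr// ler_norml.
by apply/andP; split; lra.
Qed.

End LayerCake.

(** * Power, drift and the difference of two powers *)

Section Alternatives.
Context {R : realType}.
Let RT := measurableTypeR R.
Let U := @Unif R.
Variable n : nat.
Hypothesis n0 : (0 < n)%N.
Let E := Ex (powP U n).
Let nr0 : 0 < n%:R :> R. Proof. by rewrite ltr0n. Qed.

Definition power (p : R -> R) (c : R) : R :=
  Ex (powP U n) (fun s => (c < sq_stat p s)%R%:R).

Lemma bmeas_power (p : R -> R) (c : R) : pcdf p ->
  bmeas (fun s : powT n => (c < sq_stat p s)%R%:R : R).
Proof.
by move=> [mp _]; apply: bmeas_lt; [exact: measurable_cst|case: (bmeas_sq_stat n mp)].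
Qed.

Lemma power_le1 p c : pcdf p -> power p c <= 1.
Proof. by move=> pp; apply: Ex_le_cst => [|s]; [exact: bmeas_power|rewrite lern1 leq_b1]. Qed.

Lemma power_F0_le c : 0 < c -> power (@F0 R) c <= 4^-1 / c.
Proof.
move=> c0; have p0 := @pcdf_F0 R.
have d0 : drift (@F0 R) n = 0.
  rewrite /drift /dist2 (@eq_Ex _ _ _ _ _ (fun=> 0)) ?Ex_cst ?mulr0// => t.
  by rewrite subrr expr0n.
apply: (le_trans (Ex_markov _ (bmeas_sq_stat n p0.1) (@sq_stat_ge0 R _ n) c0)).
rewrite ler_pM2r ?invr_gt0// Ex_sq_stat// d0 addr0 -(Ex_noise p0 n0).
exact: Ex_noise_le.
Qed.

(* Inconsistency bounds the right-hand side: the mean of [sq_stat r] exceeds that of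
   [sq_stat F0] by about [drift r n], and means are integrals of tail probabilities. *)
Lemma drift_le r eta J : pcdf r -> 0 < eta -> (0 < J)%N ->
  drift r n <= Ex U (fun t => `|r t - F0 t|) + eta +
    (24 + 8 * drift r n ^+ 2) / (J%:R * eta) +
    eta * \sum_(0 <= j < J) (power r (j%:R * eta) - power (@F0 R) (j%:R * eta)).
Proof.
move=> pr e0 J0; have p0 := @pcdf_F0 R.
have Je : 0 < J%:R * eta by rewrite mulr_gt0// ltr0n.
have layers q : pcdf q -> eta * \sum_(0 <= j < J) power q (j%:R * eta) =
    E (fun s => eta * \sum_(0 <= j < J) (j%:R * eta < sq_stat q s)%R%:R).
  move=> pq; rewrite /E ExZ ?Ex_sum//; do ?[apply: bmeas_sum]; by move=> j; exact: bmeas_power.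
have blay q : pcdf q ->
    bmeas (fun s : @powT R n => eta * \sum_(0 <= j < J) (j%:R * eta < sq_stat q s)%R%:R).
  by move=> pq; apply: bmeasZ; apply: bmeas_sum => j; exact: bmeas_power.
have bS q : pcdf q -> bmeas (fun s : @powT R n => sq_stat q s).
  by move=> [mq _]; exact: bmeas_sq_stat.
have up : Ex U (fun t => r t * (1 - r t)) + drift r n <=
    (24 + 8 * drift r n ^+ 2) / (J%:R * eta) + eta * \sum_(0 <= j < J) power r (j%:R * eta).
  rewrite -(Ex_sq_stat pr n0) layers//.
  (* The layers stop at [J eta]; beyond it x is at most x^2 / (J eta), which the second moment
     controls. *)
  apply: (@le_trans _ _ (E (fun s => (J%:R * eta)^-1 * sq_stat r s ^+ 2 +
      eta * \sum_(0 <= j < J) (j%:R * eta < sq_stat r s)%R%:R))).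
    apply: Ex_le; [exact: bS|by apply: bmeasD; [exact/bmeasZ/bmeasX/bS|exact: blay]|move=> s].
    have s0 := sq_stat_ge0 r s; have := layer_cake_ge J s0 e0.
    set x := sq_stat r s in s0 *; set S := eta * _.
    case: (leP x (J%:R * eta)) => h hS.
      by rewrite (le_trans hS)// ler_wpDl// mulr_ge0 ?sqr_ge0// invr_ge0 ltW.
    have S0 : 0 <= S by rewrite (le_trans (ltW Je)).
    apply: ler_wpDr => //; rewrite mulrC ler_pdivlMr// expr2.
    by rewrite ler_pM2l ?ltW// (lt_trans Je).
  rewrite /E ExD; [|exact/bmeasZ/bmeasX/bS|exact: blay].
  rewrite lerD2r ExZ; last exact/bmeasX/bS.
  by rewrite mulrC ler_pM2r ?invr_gt0// Ex_sq_stat2_le.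
have lo : eta * \sum_(0 <= j < J) power (@F0 R) (j%:R * eta) <=
    Ex U (fun t => F0 t * (1 - F0 t)) + eta.
  have d0 : drift (@F0 R) n = 0.
    rewrite /drift /dist2 (@eq_Ex _ _ _ _ _ (fun=> 0)) ?Ex_cst ?mulr0// => t.
    by rewrite subrr expr0n.
  have -> : Ex U (fun t => F0 t * (1 - F0 t)) + eta = E (fun s => sq_stat (@F0 R) s + eta).
    rewrite /E ExD; [|exact: bS|exact: bmeas_cst].
    by rewrite (Ex_sq_stat p0 n0) d0 addr0 Ex_cst.
  rewrite layers//.
  apply: Ex_le; [exact: blay|by apply: bmeasD; [exact: bS|exact: bmeas_cst]|move=> s].
  by apply: (le_trans (layer_cake_le J (sq_stat_ge0 _ s) e0)); rewrite ge_min lexx.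
have bvar q : pcdf q -> @bmeas R _ RT (fun t => q t * (1 - q t)).
  move=> /pcdf_bmeas bq; apply: bmeasM => //; apply: bmeasB => //; exact: bmeas_cst.
have bn : @bmeas R _ RT (fun t => `|r t - F0 t|).
  by apply: bmeas_norm; apply: bmeasB; exact: pcdf_bmeas.
(* The variance parts of the two means differ as well; this is the first error term. *)
have lip : Ex U (fun t => F0 t * (1 - F0 t)) - Ex U (fun t => r t * (1 - r t)) <=
    Ex U (fun t => `|r t - F0 t|).
  rewrite -ExB; [|exact: bvar|exact: bvar].
  apply: Ex_le => // [|t]; first by apply: bmeasB; exact: bvar.
  by apply: var_lipschitz; [exact: pr.2|exact: F0_01].
rewrite sumrB mulrBr.
have chain (u d x y z v w : R) : u + d <= x + y -> z <= v + eta -> v - u <= w ->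
    d <= w + eta + x + (y - z) by clear -eta; lra.
exact: chain up lo lip.
Qed.

(** On a common sample the two tests can disagree only if the first statistic is within [k] of the
    threshold or the gap exceeds the tolerance. *)
Lemma power_sub_le p q c C k : pcdf p -> pcdf q -> 0 <= C -> 0 < k -> c <= C ->
  `|power p c - power q c| <=
  E (fun s => (`|sq_stat p s - c| <= k)%R%:R) +
  (2 * Ex U (fun t => `|p t - q t|) + 2 * (n%:R * dist2 p q)) / tolerance C k.
Proof.
move=> pp pq C0 k0 cC; have tol0 := tolerance_gt0 C0 k0.
pose gap (s : powT n) := Ex U (fun t => (dev p s t - dev q s t) ^+ 2) / n%:R.
have bgap : bmeas gap.
  rewrite /gap; under eq_fun do rewrite mulrC; apply: bmeasZ.
  apply: (@bmeas_Ex _ _ _ (powT n) RT U (fun z => (dev p z.1 z.2 - dev q z.1 z.2) ^+ 2)).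
  by apply/bmeasX/bmeas_dev_sub_joint.
have gap0 s : 0 <= gap s.
  by rewrite mulr_ge0 ?invr_ge0//; apply: Ex_ge0 => t; exact: sqr_ge0.
have bl : bmeas (fun s : powT n => (tolerance C k < gap s)%R%:R : R).
  by apply: bmeas_lt; [exact: measurable_cst|case: bgap].
have bw := @bmeas_window R n p c k pp.
have bP := bmeas_power c pp; have bQ := bmeas_power c pq.
rewrite -ExB//; apply: (le_trans (Ex_norm_le _ (bmeasB bP bQ))).
apply: (@le_trans _ _ (E (fun s => (`|sq_stat p s - c| <= k)%R%:R + (tolerance C k < gap s)%R%:R))).
  apply: Ex_le; [exact/bmeas_norm/bmeasB|exact: bmeasD|move=> s].
  have dif : `|(c < sq_stat p s)%R%:R - (c < sq_stat q s)%R%:R| <= 1 :> R.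
    by case: (c < sq_stat p s); case: (c < sq_stat q s);
      rewrite /= ?subrr ?subr0 ?sub0r ?normrN ?normr0 ?normr1.
  case: (leP `|sq_stat p s - c| k) => w; first by rewrite (le_trans dif)// ler_wpDr.
  case: (ltP (tolerance C k) (gap s)) => small; first by rewrite (le_trans dif)// ler_wpDl.
  have bs1 : @bmeas R _ RT (dev p s) by apply: bmeas_dev; case: pp.
  have bs2 : @bmeas R _ RT (dev q s) by apply: bmeas_dev; case: pq.
  have AB := dominates_upto_sq n0 bs1 bs2.
  have BA : dominates_upto (sq_stat q s) (sq_stat p s) (gap s).
    have := dominates_upto_sq n0 bs2 bs1.
    rewrite (_ : Ex U (fun t => (dev q s t - _ t) ^+ 2) / _ = gap s)//.
    by congr (_ / _); apply: eq_Ex => t; rewrite -sqrrN opprB.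
  by rewrite (test_transfer C0 k0 small cC AB BA w) subrr normr0 addr0.
rewrite /E ExD// lerD2l (le_trans (Ex_markov _ bgap gap0 tol0))//.
by rewrite ler_pM2r ?invr_gt0// Ex_gap.
Qed.

End Alternatives.

(** * Asymptotics *)

Section Asymptotics.
Context {R : realType}.
Let RT := measurableTypeR R.
Let U := @Unif R.
Implicit Types (P Q : nat -> probability RT R).

Lemma on01_Unif : on01 U.
Proof. by apply: (integral_uniform_pdf1 ltr01) => x. Qed.

Lemma limn_einf_near (u : nat -> R) (l e : R) : 0 < e ->
  (l%:E <= limn_einf (fun n => (u n)%:E))%E -> \forall n \near \oo, l - e <= u n.
Proof.
move=> e0; rewrite limn_einf_lim.
have -> : limn (einfs (fun n => (u n)%:E)) = ereal_sup (range (einfs (fun n => (u n)%:E))).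
  by apply/cvg_lim => //; exact: cvg_einfs_sup.
move=> lu; have [_ [N _ <-] Nl] : exists2 x, range (einfs (fun n => (u n)%:E)) x & ((l - e)%:E < x)%E.
  by apply: ereal_sup_gt; apply: lt_le_trans lu; rewrite lte_fin; lra.
exists N => // n /= Nn; rewrite -lee_fin (le_trans (ltW Nl))//.
by apply: ereal_inf_lbound; exists n.
Qed.

Lemma rej_power P n c : on01 (P n) -> rej (P n) n c = power n (distr_fun (P n)) c.
Proof. exact: rejE. Qed.

Lemma rej_power0 n c : rej U n c = power n (@F0 R) c.
Proof.
rewrite rejE; last exact: on01_Unif.
by rewrite (_ : distr_fun _ = @F0 R)//; apply/funext => x; exact: distr_Unif.
Qed.

Lemma dist2_drift (p : R -> R) n : (0 < n)%N -> dist2 p (@F0 R) = drift p n / n%:R.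
Proof. by move=> n0; rewrite /drift [n%:R * _]mulrC mulfK// pnatr_eq0 -lt0n. Qed.

Lemma near_all_below (A : nat -> nat -> Prop) J :
  (forall j, \forall n \near \oo, A j n) ->
  \forall n \near \oo, forall j, (0 <= j < J)%N -> A j n.
Proof.
move=> h; elim: J => [|J IH]; first by apply: nearW => n j /andP[_]; rewrite ltn0.
apply: filterS (filterI (h J) IH) => n [hJ hn] j /andP[_].
by rewrite ltnS leq_eqVlt => /orP[/eqP ->//|jJ]; exact: hn.
Qed.

(** Read [a] and [b] as the powers at threshold 4 under the alternative and the null. The first two
    bounds give [a] at most 5/16, whereas a drift above 10 would give at least 3/4. *)
Lemma bounded_of_power (d a b : R) : a - b <= 4^-1 -> b <= 4^-1 / 4 ->
  (4 < d / 2 -> 1 - a <= 4^-1 / (d / 2 - 4)) -> d <= 10.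
Proof.
move=> ab b4 h; rewrite leNgt; apply/negP => d10.
have d4 : 4 < d / 2 by lra.
have i4 : 4^-1 / (d / 2 - 4) <= 4^-1.
  by rewrite ler_pdivrMr; [|lra]; rewrite ler_peMr//; lra.
by have := h d4; lra.
Qed.

Lemma inconsistent_drift P : (forall n, on01 (P n)) -> inconsistent P ->
  forall e, 0 < e -> \forall n \near \oo, drift (distr_fun (P n)) n <= e.
Proof.
move=> P01 incP.
have pr n := pcdf_distr (P n).
have ineq (x e : R) : 0 < e -> \forall n \near \oo,
    power n (distr_fun (P n)) x - power n (@F0 R) x <= e.
  (* Inconsistency is applied to a constant sequence of thresholds. *)
  move=> e0; have := limn_einf_near e0 (incP (fun=> x)).
  have num (a b : R) : 1 - e <= b + (1 - a) -> a - b <= e by clear; lra.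
  by apply: filterS => n; rewrite /alphaK /betaK rej_power0 rej_power//; exact: num.
(* The truncation error in [drift_le] contains the squared drift, so an a priori bound must precede
   the choice of [J]. *)
have bounded : \forall n \near \oo, drift (distr_fun (P n)) n <= 10.
  near=> n.
  have n0 : (0 < n)%N by near: n; exact: nbhs_infty_gt.
  have i1 : power n (distr_fun (P n)) 4 - power n (@F0 R) 4 <= 4^-1.
    by near: n; apply: ineq; rewrite invr_gt0.
  have i2 : power n (@F0 R) 4 <= 4^-1 / 4 by apply: power_F0_le.
  exact: bounded_of_power i1 i2 (Ex_sq_stat_lower (pr n) n0 (c := 4)).
suff small e : 0 < e -> \forall n \near \oo, drift (distr_fun (P n)) n <= 4 * e.
  move=> e e0; have : 0 < e / 4 by rewrite divr_gt0.
  by move=> /small; apply: filterS => n; rewrite mulrC divfK.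
move=> e0.
have [B B0 BE] : exists2 B : R, 0 <= B & forall y, y <= 10 ^+ 2 -> 24 + 8 * y <= B.
  exists (24 + 8 * 10 ^+ 2); first by rewrite addr_ge0// mulr_ge0// exprn_ge0.
  by move=> y y10; rewrite lerD2l ler_pM2l.
(* Makes the truncation error [B / (J e)] at most [e]. *)
pose J := (Num.bound (B / e ^+ 2)).+1.
have Jr : B / e ^+ 2 <= J%:R.
  have q0 : 0 <= B / e ^+ 2 by rewrite divr_ge0 ?sqr_ge0.
  by apply: (le_trans (ltW (archi_boundP q0))); rewrite ler_nat leqnSn.
have Je : 0 < J%:R * e by rewrite mulr_gt0// ltr0n.
near=> n.
have n0 : (0 < n)%N by near: n; exact: nbhs_infty_gt.
have nr0 : 0 < n%:R :> R by rewrite ltr0n.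
have d10 : drift (distr_fun (P n)) n <= 10 by near: n; exact: bounded.
(* With 1/J at each of the [J] thresholds, the sum weighted by the mesh [e] stays below [e]. *)
have tj : forall j, (0 <= j < J)%N ->
    power n (distr_fun (P n)) (j%:R * e) - power n (@F0 R) (j%:R * e) <= J%:R^-1.
  near: n; apply: near_all_below => j; apply: ineq.
  by rewrite invr_gt0 ltr0n.
have nl : 10 / e ^+ 2 <= n%:R by near: n; exact: nbhs_infty_ger.
move: d10 tj; set r := distr_fun (P n); set d := drift r n => d10 tj.
have d0 : 0 <= d := drift_ge0 r n.
have t1 : Ex U (fun t => `|r t - F0 t|) <= e.
  rewrite -(@ler_pXn2r _ 2)// ?nnegrE ?(ltW e0)//; last by apply: Ex_ge0.
  apply: (le_trans (Ex_norm_dist2 (pr n) pcdf_F0)).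
  rewrite (dist2_drift r n0) -/d.
  rewrite ler_pdivrMr// (le_trans d10)// mulrC -ler_pdivrMr// exprn_gt0//.
have t2 : (24 + 8 * d ^+ 2) / (J%:R * e) <= e.
  rewrite ler_pdivrMr//.
  have -> : e * (J%:R * e) = J%:R * e ^+ 2 by ring.
  apply: (@le_trans _ _ B); last by rewrite -ler_pdivrMr// exprn_gt0.
  by apply: BE; rewrite lerXn2r ?nnegrE.
have t3 : e * \sum_(0 <= j < J) (power n r (j%:R * e) - power n (@F0 R) (j%:R * e)) <= e.
  rewrite ler_piMr ?(ltW e0)// (le_trans (ler_sum_nat tj))//.
  by rewrite sumr_const_nat subn0 -[_^-1 *+ _]mulr_natl mulfV// pnatr_eq0.
have := drift_le n0 (pr n) e0 (ltn0Sn _ : (0 < J)%N); rewrite -/r -/d.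
have num (x y z : R) : x <= e -> y <= e -> z <= e -> d <= x + e + y + z -> d <= 4 * e.
  by clear; lra.
exact: num.
Unshelve. all: by end_near. Qed.

(** The level is eventually at least a/2, while Markov's inequality bounds it by 1/(4 c). A common
    bound on the thresholds makes the tolerance independent of n. *)
Lemma asym_level_bounded (c : nat -> R) a : 0 < a -> asym_level c a ->
  \forall n \near \oo, c n <= (2 * a)^-1.
Proof.
move=> a0 /cvgrPdist_le/(_ (2^-1)) lev; near=> n.
have n0 : (0 < n)%N by near: n; exact: nbhs_infty_gt.
have : `|1 - alphaK c n / a| <= 2^-1 by near: n; apply: lev; rewrite invr_gt0.
rewrite /alphaK rej_power0 ler_norml => /andP[_ h].
rewrite leNgt; apply/negP => cn; have a2 : 0 < (2 * a)^-1 by rewrite invr_gt0 mulr_gt0.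
have c0 := lt_trans a2 cn.
have pc : power n (@F0 R) (c n) < 2^-1 * a.
  apply: (le_lt_trans (power_F0_le n0 c0)).
  rewrite ltr_pdivrMr// -ltr_pdivrMl ?mulr_gt0//; apply: le_lt_trans cn.
  by rewrite le_eqVlt; apply/orP; left; apply/eqP; field; rewrite gt_eqF.
have num (x : R) : 1 - x <= 2^-1 -> ~ (x < 2^-1) by clear; lra.
by apply: (num _ h); rewrite ltr_pdivrMr.
Unshelve. all: by end_near. Qed.

Lemma power_large_drift n (p : R -> R) (c C e : R) : (0 < n)%N -> pcdf p -> c <= C -> 0 < e ->
  C + (4 * e)^-1 <= drift p n / 2 -> 1 - e <= power n p c.
Proof.
move=> n0 pp cC e0 big.
have num (d : R) : C + (4 * e)^-1 <= d -> c < d /\ 4^-1 / (d - c) <= e.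
  clear -cC e0 => h; have e4 : 0 < (4 * e)^-1 by rewrite invr_gt0 mulr_gt0.
  have dc : (4 * e)^-1 <= d - c by lra.
  split; first by lra.
  have d0 : 0 < d - c := lt_le_trans e4 dc.
  rewrite ler_pdivrMr// -ler_pdivrMl//; apply: le_trans dc.
  by rewrite le_eqVlt invfM mulrC eqxx.
have [cd h] := num _ big.
have := le_trans (Ex_sq_stat_lower pp n0 cd) h.
by rewrite -/(power n p c) lerBlDr addrC -lerBlDr.
Qed.

Lemma drift_perturb n (p q : R -> R) : pcdf p -> pcdf q ->
  drift p n / 2 - n%:R * dist2 p q <= drift q n.
Proof.
move=> pp pq; rewrite /drift -mulrA -mulrBr ler_wpM2l//.
have bF := @bmeas_F0 R; have bp := pcdf_bmeas pp; have bq := pcdf_bmeas pq.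
have b1 := bmeasX 2 (bmeasB bp bF); have b2 := bmeasX 2 (bmeasB bp bq).
rewrite /dist2 mulrC -ExZ// -ExB//; last exact: bmeasZ.
apply: Ex_le; [by apply: bmeasB => //; exact: bmeasZ|exact/bmeasX/bmeasB|move=> t].
have num (x y z : R) : 2^-1 * (x - z) ^+ 2 - (x - y) ^+ 2 <= (y - z) ^+ 2.
  by clear; have := sqr_ge0 (2 * (x - y) - (x - z)); rewrite !expr2; lra.
exact: num.
Qed.

(** The width [k] precedes [n], [p] and the threshold, so the tolerance is fixed before the drift of
    the inconsistent sequence is sent below it. *)
Lemma window_small (C D0 e : R) : 0 <= C -> 0 < e -> exists2 k : R, 0 < k &
  \forall n \near \oo, forall (p : R -> R) c, pcdf p -> c <= C -> drift p n <= D0 ->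
    Ex (powP U n) (fun s => (`|sq_stat p s - c| <= k)%R%:R) <= 3 * e.
Proof.
move=> C0 e0; pose J := (Num.bound (2 / e)).+1.
have Jr0 : 0 < J%:R :> R by rewrite ltr0n.
have Jr : 2 / J%:R <= e.
  rewrite ler_pdivrMr// mulrC -ler_pdivrMr//.
  have q0 : 0 <= 2 / e by rewrite divr_ge0// ltW.
  by apply: (le_trans (ltW (archi_boundP q0))); rewrite ler_nat leqnSn.
pose m := Num.min 1 (e ^+ 2); have m0 : 0 < m by rewrite lt_min ltr01 exprn_gt0.
have m1 : m <= 1 by rewrite ge_min lexx.
have me : m <= e ^+ 2 by rewrite ge_min lexx orbT.
(* The value of [n h^2]; it turns 2 J^2 n h^2 into [m], which meets both smallness conditions on the
   tilt. *)
pose sg := m / (2 * J%:R ^+ 2).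
have sg0 : 0 < sg by rewrite divr_gt0// mulr_gt0// exprn_gt0.
have Jsg : 2 * (J%:R ^+ 2 * sg) = m by rewrite /sg; field; rewrite gt_eqF.
(* Here [sg / 128] bounds the leading coefficient from below, by [Ex_mid2_ge], and [4 * k] is half
   of it. *)
pose k := sg * 128^-1 / 8; have k0 : 0 < k by rewrite divr_gt0// mulr_gt0// invr_gt0.
have k4 : 4 * k < sg * 128^-1.
  have : 0 < sg * 128^-1 by rewrite mulr_gt0// invr_gt0.
  by rewrite /k; move: (sg * _) => y y0; clear -y0; lra.
exists k => //; have tol0 := tolerance_gt0 C0 k0; near=> n => p c pp cC dD.
have n0 : (0 < n)%N by near: n; exact: nbhs_infty_gt.
have nr0 : 0 < n%:R :> R by rewrite ltr0n.
have nr1 : 1 <= n%:R :> R by rewrite ler1n.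
have nD : D0 / 128^-1 <= n%:R by near: n; exact: nbhs_infty_ger.
have nt : ((e * tolerance C k) ^+ 2)^-1 <= n%:R by near: n; exact: nbhs_infty_ger.
have dp : dist2 p (@F0 R) <= 128^-1.
  rewrite (dist2_drift p n0) ler_pdivrMr// mulrC -ler_pdivrMr ?invr_gt0//.
  by apply: le_trans nD; rewrite ler_pM2r// invr_gt0 invr_gt0.
pose h := Num.sqrt (sg / n%:R).
have h0 : 0 < h by rewrite sqrtr_gt0 divr_gt0.
have nh : n%:R * h ^+ 2 = sg.
  have q0 : 0 <= sg / n%:R by rewrite divr_ge0// ltW.
  by rewrite /h sqr_sqrtr//; field; rewrite gt_eqF.
have Jh0 : 0 <= J%:R * h by rewrite mulr_ge0// ltW.
have Jh2 : n%:R * (J%:R * h) ^+ 2 < 1.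
  rewrite exprMn mulrCA nh; apply: lt_le_trans m1; rewrite -Jsg.
  by rewrite ltr_pMl ?ltr1n// mulr_gt0// exprn_gt0.
have Jh1 : J%:R * h < 1.
  rewrite -(@ltr_pXn2r _ 2)// ?nnegrE// expr1n; apply: le_lt_trans Jh2.
  by rewrite ler_peMl// exprn_ge0.
have Jht : J%:R * h / tolerance C k <= e.
  have et : 0 <= e * tolerance C k by exact: mulr_ge0 (ltW e0) (ltW tol0).
  rewrite ler_pdivrMr// -(@ler_pXn2r _ 2)// ?nnegrE//.
  have et0 : 0 < (e * tolerance C k) ^+ 2 by rewrite exprn_gt0// mulr_gt0.
  rewrite -(ler_pM2l nr0) (le_trans (ltW Jh2))//.
  by rewrite -ler_pdivrMr// div1r.
have km : 4 * k < n%:R * h ^+ 2 * Ex U (fun t => mid p t ^+ 2).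
  by rewrite nh (lt_le_trans k4)// ler_pM2l// Ex_mid2_ge.
have s1 : 2 * (J%:R ^+ 2 * (n%:R * h ^+ 2)) <= 1 by rewrite nh Jsg.
have s2 : 2 * (J%:R ^+ 2 * (n%:R * h ^+ 2)) <= e ^+ 2 by rewrite nh Jsg.
have ac := @anti_concentration R n p n0 pp J h c C k e (ltn0Sn _) h0 Jh1 (ltW e0) s1 s2 C0 k0 cC km.
apply: (le_trans ac).
have num (x y : R) : x <= e -> y <= e -> x + y + e <= 3 * e by clear; lra.
exact: num.
Unshelve. all: by end_near. Qed.

End Asymptotics.

Theorem theorem19 (R : realType) (a : R) (Fn F1n F2n : nat -> probability (measurableTypeR R) R) :
  0 < a < 1 ->
  (forall n, on01 (Fn n)) -> (forall n, on01 (F1n n)) -> (forall n, on01 (F2n n)) ->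
  consistent Fn -> inconsistent F1n ->
  (forall n x, distr_fun (F2n n) x = distr_fun (Fn n) x + distr_fun (F1n n) x - F0 x) ->
  forall c : nat -> R, asym_level c a ->
    (fun n => betaK Fn c n - betaK F2n c n) @ \oo --> (0 : R).

Proof.
move=> /andP[a0 _] F01 F101 F201 _ inc F2E c lev; apply/cvgr0Pnorm_le => eps eps0.
pose C := (2 * a)^-1; have C0 : 0 <= C by rewrite invr_ge0 mulr_ge0// ltW.
(* Three parts go to the window and one to the gap. *)
pose e := eps / 4; have e0 : 0 < e by rewrite divr_gt0.
(* Going over to F_2n halves the drift and subtracts at most 1; above [D0] the remainder still
   suffices for [power_large_drift]. *)
pose D0 := 4 * (C + (4 * e)^-1) + 2.
have [k k0 win] := @window_small R C D0 e C0 e0.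
have tol0 := tolerance_gt0 C0 k0.
pose dl := e * tolerance C k / 4; have dl0 : 0 < dl by rewrite divr_gt0// mulr_gt0.
pose d1 n := drift (distr_fun (F1n n)) n.
near=> n.
have n0 : (0 < n)%N by near: n; exact: nbhs_infty_gt.
have nr1 : 1 <= n%:R :> R by rewrite ler1n.
have cC : c n <= C by near: n; exact: asym_level_bounded.
have da : d1 n <= 1 by near: n; exact: inconsistent_drift.
have db : d1 n <= dl by near: n; exact: inconsistent_drift.
(* The gap bound also involves the L^1 distance, controlled by the square root of the drift. *)
have dc : d1 n <= dl ^+ 2 by near: n; apply: inconsistent_drift => //; rewrite exprn_gt0.
have winn : forall (p : R -> R) x, pcdf p -> x <= C -> drift p n <= D0 ->
    Ex (powP (@Unif R) n) (fun s => (`|sq_stat p s - x| <= k)%R%:R) <= 3 * e.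
  by near: n; exact: win.
set p := distr_fun (Fn n); set q := distr_fun (F2n n); set r := distr_fun (F1n n).
have pp : pcdf p := pcdf_distr _; have pq : pcdf q := pcdf_distr _.
have pr : pcdf r := pcdf_distr _.
(* Hence the distance between F_n and F_2n, scaled by n, is exactly the drift of F_1n. *)
have pqE t : p t - q t = - (r t - F0 t) by rewrite /q F2E -/p -/r; ring.
have nd : n%:R * dist2 p q = d1 n.
  by congr (_ * _); apply: eq_Ex => t; rewrite pqE sqrrN.
have I1 : Ex (@Unif R) (fun t => `|p t - q t|) <= dl.
  have -> : Ex (@Unif R) (fun t => `|p t - q t|) = Ex (@Unif R) (fun t => `|r t - F0 t|).
    by apply: eq_Ex => t; rewrite pqE normrN.
  rewrite -(@ler_pXn2r _ 2)// ?nnegrE ?(ltW dl0)//; last by apply: Ex_ge0.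
  apply: (le_trans (Ex_norm_dist2 pr (@pcdf_F0 R))); apply: le_trans dc.
  rewrite (dist2_drift r n0) ler_pdivrMr ?ltr0n//.
  by rewrite ler_peMr// drift_ge0.
rewrite /betaK !rejE// -/p -/q -/(power n p (c n)) -/(power n q (c n)).
have num1 (x y : R) : `|1 - x - (1 - y)| = `|x - y|.
  by rewrite [RHS]distrC; congr `| _ |; ring.
rewrite num1 {num1}.
have [dD|dD] := leP (drift p n) D0.
  apply: (le_trans (power_sub_le n0 pp pq C0 k0 cC)); rewrite nd.
  have w2 : (2 * Ex (@Unif R) (fun t => `|p t - q t|) + 2 * d1 n) / tolerance C k <= e.
    rewrite ler_pdivrMr// (_ : e * tolerance C k = 2 * dl + 2 * dl); last by rewrite /dl; field.
    by rewrite lerD// ler_pM2l.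
  have num2 (x y : R) : x <= 3 * e -> y <= e -> x + y <= eps by rewrite /e; clear; lra.
  by apply: num2 w2; exact: winn.
have num3 (x y : R) : x <= 1 -> y <= 1 -> 1 - e <= x -> 1 - e <= y -> `|x - y| <= eps.
  move: eps0; rewrite /e; clear => eps0 x1 y1 xe ye; rewrite ler_norml.
  by apply/andP; split; lra.
have num4 (d d' x : R) : D0 < d -> x <= 1 -> d / 2 - x <= d' ->
    C + (4 * e)^-1 <= d / 2 /\ C + (4 * e)^-1 <= d' / 2.
  have c0 : 0 <= C + (4 * e)^-1 by rewrite addr_ge0// invr_ge0 mulr_ge0// ltW.
  by move: c0; rewrite /D0; move: (C + _) => y; clear => y0 *; split; lra.
have pert := drift_perturb n pp pq; rewrite nd in pert.
have [bp bq] := num4 _ _ _ dD da pert.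
apply: num3; do ?exact: power_le1.
- exact: power_large_drift bp.
- exact: power_large_drift bq.
Unshelve. all: by end_near. Qed.
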